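(* Let $I\subset K[x_1,\ldots,x_n]$ be a graded prime ideal of dimension $m<n$. Then, as sets, $\mathrm{gT}(I)=\mathcal{W}_n^m$.
   Context: $K$ is an algebraically closed field of characteristic $0$ with trivial valuation; $\dim I$ is the Krull dimension of $K[x_1,\ldots,x_n]/I$. Each $g=(g_{ij})\in\mathrm{GL}_n(K)$ acts by $x_i\mapsto\sum_j g_{ij}x_j$. For $f=\sum_\nu a_\nu x^\nu$ and $\omega\in\mathbb{R}^n$, $\mathrm{in}_\omega(f)$ is the sum of the terms with $\omega\cdot\nu$ minimal, and $T(I)=\{\omega:\mathrm{in}_\omega(f)\text{ is not a monomial for every }f\in I\}$. The generic tropical variety $\mathrm{gT}(I)$ is the set equal to $T(g(I))$ for all $g$ in a non-empty Zariski-open subset of $\mathrm{GL}_n(K)$ (it exists). The generic tropical fan $\mathcal{W}_n$ consists of the cones $C_A=\{\omega\in\mathbb{R}^n:\omega_i=\min_k\omega_k\text{ for all }i\in A\}$ for nonempty $A\subset\{1,\ldots,n\}$ ($\dim C_A=n-|A|+1$), and $\mathcal{W}_n^m$ is its $m$-skeleton (cones of dimension at most $m$); as a set it is the set of $\omega$ whose minimal coordinate is attained at least $n-m+1$ times. *)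

(* Defs.v *)
From HB Require Import structures.
From mathcomp Require Import all_boot all_order all_algebra.
From mathcomp Require Import reals.
From mathcomp Require Import mpoly.

Set Implicit Arguments.
Unset Strict Implicit.
Unset Printing Implicit Defensive.

Import Order.TTheory GRing.Theory Num.Theory.
Local Open Scope ring_scope.

Definition polyset (K : fieldType) (n : nat) := {mpoly K[n]} -> Prop.

Section Ideals.
Variables (K : fieldType) (n : nat).
Implicit Types (I : polyset K n) (f : {mpoly K[n]}).

Definition is_ideal I : Prop :=
  [/\ I 0, (forall f g, I f -> I g -> I (f + g)) & (forall f g, I f -> I (g * f))].

Definition is_prime I : Prop :=
  [/\ is_ideal I, ~ I 1 & (forall f g, I (f * g) -> I f \/ I g)].

Definition hcomp (d : nat) f : {mpoly K[n]} :=
  \sum_(m <- msupp f | mdeg m == d) f@_m *: 'X_[m].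

Definition is_graded I : Prop :=
  is_ideal I /\ forall f, I f -> forall d, I (hcomp d f).

(* Krull dimension of K[x]/I equals d: there is a chain of d+1 primes
   P_0 < ... < P_d containing I (a chain of length d), and none of length d+1. *)
Definition prime_chain I (d : nat) : Prop :=
  exists P : nat -> polyset K n,
    (forall k, (k <= d)%N -> is_prime (P k) /\ (forall f, I f -> P k f)) /\
    (forall k, (k < d)%N ->
       (forall f, P k f -> P k.+1 f) /\ exists f, P k.+1 f /\ ~ P k f).

Definition quot_dim I (d : nat) : Prop := prime_chain I d /\ ~ prime_chain I d.+1.

Definition gact (g : 'M[K]_n) f : {mpoly K[n]} :=
  f \mPo [tuple \sum_(j < n) g i j *: 'X_j | i < n].

Definition gact_set (g : 'M[K]_n) I : polyset K n :=
  fun p => exists f, I f /\ p = gact g f.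

End Ideals.

Section Tropical.
Variables (R : realType) (K : fieldType) (n : nat).

Definition wdot (w : 'rV[R]_n) (m : 'X_{1..n}) : R := \sum_(i < n) w 0 i * (m i)%:R.

Definition initf (w : 'rV[R]_n) (f : {mpoly K[n]}) : {mpoly K[n]} :=
  \sum_(m <- msupp f | all (fun m' => wdot w m <= wdot w m') (msupp f))
     f@_m *: 'X_[m].

Definition is_monomial (p : {mpoly K[n]}) : Prop :=
  exists (c : K) (m : 'X_{1..n}), c != 0 /\ p = c *: 'X_[m].

Definition trop (I : polyset K n) (w : 'rV[R]_n) : Prop :=
  forall f, I f -> ~ is_monomial (initf w f).

Definition cone_C (A : {set 'I_n}) (w : 'rV[R]_n) : Prop :=
  forall i, i \in A -> forall k, w 0 i <= w 0 k.

(* the m-skeleton W_n^m: union of the cones C_A (A nonempty) of dimension n-|A|+1 <= m *)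
Definition skeleton (m : nat) (w : 'rV[R]_n) : Prop :=
  exists A : {set 'I_n}, A != set0 /\ (n - #|A| + 1 <= m)%N /\ cone_C A w.

End Tropical.

Definition zariski_open_GL (K : fieldType) (n : nat) (U : 'M[K]_n -> Prop) : Prop :=
  exists S : {mpoly K[n * n]} -> Prop,
    forall g, U g <-> (g \in unitmx /\ exists p, S p /\ p.@[fun i => mxvec g 0 i] != 0).

(* Main.v *)
(* Put J = g(I) and write x_B for the variables indexed by B.  Two facts hold
   for all g in a non-empty open set and all B with |B| = m: J + (x_B) contains
   a power of every variable, and J meets K[x_B] in 0.

   The first fact is Noether normalization for one g and one B; coordinate
   permutations give it for every B, and it is an open condition because it says
   that an evaluation matrix with entries polynomial in g is invertible.  The
   right number of variables is m because a chain of k + 1 primes produces, in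
   degrees O(s), s^k linearly independent polynomials mod J, while finiteness
   over x_B leaves only O(s^|B|) of them; conversely, finiteness over
   algebraically independent variables yields a prime chain of length |B|.  The
   second fact follows, since a relation in K[x_B] would allow one more
   normalization step and finiteness over m - 1 variables.

   If the minimum of w is attained on at most n - m coordinates, choose B, with
   |B| = m, among the others: the element x_i^N + (terms in (x_B)) of J, with
   w_i minimal, has initial form x_i^N.

   If the minimum is attained at least n - m + 1 times, shift and perturb w so
   that it is positive exactly on B with |B| = m - 1, and add an index i0 to get
   T.  A monomial initial form gives a monomial in J + (terms of larger weight),
   and the first fact moves it to a monomial u in x_T.  Since K[x]/J is a finite
   K[x_T]-module, multiplication by u is there given by a matrix Q over K[x_T] of
   larger weight, and det(u - Q) = u^r + (larger weight) is a non-zero element of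
   J and of K[x_T]. *)

Require Import Defs.
From HB Require Import structures.
From mathcomp Require Import all_boot all_order all_algebra.
From mathcomp Require Import reals.
From mathcomp Require Import fingroup perm mpoly.
From mathcomp Require Import zify ring lra.
From mathcomp Require boolp classical_sets.
Set Implicit Arguments.
Unset Strict Implicit.
Unset Printing Implicit Defensive.
Import Order.TTheory GRing.Theory Num.Theory.
Local Open Scope ring_scope.

(** * Substitutions and restriction to coordinate subspaces *)

Section Substitution.
Variables (K : fieldType) (n : nat).
Implicit Types (h : 'I_n -> {mpoly K[n]}) (f : {mpoly K[n]}).

(** Common form of [restr] and [gact], so that [subst_subst] handles all of their composites. *)
Definition subst h f : {mpoly K[n]} := f \mPo [tuple h i | i < n].

Lemma subst_is_linear h : linear (subst h).
Proof. by move=> a p q; rewrite /subst linearP. Qed.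
HB.instance Definition _ h := GRing.isLinear.Build K {mpoly K[n]} {mpoly K[n]}
  *:%R (subst h) (subst_is_linear h).

Lemma subst_is_monoid_morphism h : monoid_morphism (subst h).
Proof. by split=> [|p q]; rewrite /subst ?rmorph1 ?rmorphM. Qed.
HB.instance Definition _ h := GRing.isMonoidMorphism.Build {mpoly K[n]}
  {mpoly K[n]} (subst h) (subst_is_monoid_morphism h).

Lemma substX h m : subst h 'X_[m] = \prod_(i < n) h i ^+ m i.
Proof. by rewrite /subst comp_mpolyX; apply: eq_bigr => i _; rewrite tnth_mktuple. Qed.

Lemma substXU h i : subst h 'X_i = h i.
Proof. by rewrite /subst comp_mpolyXU -tnth_nth tnth_mktuple. Qed.

Lemma substE h f : subst h f = \sum_(m <- msupp f) f@_m *: \prod_(i < n) h i ^+ m i.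
Proof.
rewrite {1}[f]mpolyE linear_sum; apply: eq_bigr => m _.
by rewrite linearZ /= substX.
Qed.

Lemma eq_subst h1 h2 f : h1 =1 h2 -> subst h1 f = subst h2 f.
Proof.
by move=> e; rewrite !substE; apply: eq_bigr => m _; congr (_ *: _);
  apply: eq_bigr => i _; rewrite e.
Qed.

Lemma subst_subst h1 h2 f : subst h2 (subst h1 f) = subst (fun i => subst h2 (h1 i)) f.
Proof.
rewrite (substE h1) linear_sum [in RHS]substE; apply: eq_bigr => m _.
by rewrite linearZ /= rmorph_prod; congr (_ *: _); apply: eq_bigr => i _; rewrite rmorphXn.
Qed.

Lemma subst_id f : subst (fun i => 'X_i) f = f.
Proof. exact: comp_mpoly_id. Qed.

End Substitution.

Section Restriction.
Variables (K : fieldType) (n : nat).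
Implicit Types (B C : {set 'I_n}) (f : {mpoly K[n]}).

(** The kernel is the ideal (x_B), so congruence modulo (x_B) becomes an equation between
    restrictions. *)
Definition restr B f := subst (fun i => if i \in B then 0 else 'X_i) f.
HB.instance Definition _ B := GRing.LRMorphism.copy (restr B)
  (subst (fun i => if i \in B then 0 else 'X_i)).

Lemma restrXU B i : restr B 'X_i = if i \in B then 0 else 'X_i.
Proof. exact: substXU. Qed.

Lemma restrX B m :
  restr B 'X_[m] = if [forall i in B, m i == 0%N] then 'X_[m] else 0.
Proof.
rewrite /restr substX; case: ifP => [/'forall_implyP mB0|/negbT].
  rewrite mpolyXE_id; apply: eq_bigr => i _; case: ifP => // iB.
  by rewrite (eqP (mB0 i iB)) !expr0.
case/forall_inPn => i iB mi0.
by rewrite (bigD1 i) //= iB expr0n (negbTE mi0) mul0r.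
Qed.

Lemma mcoeff_restr B f m :
  (restr B f)@_m = if [forall i in B, m i == 0%N] then f@_m else 0.
Proof.
rewrite [f in LHS]mpolyE (linear_sum (restr B)) raddf_sum /=.
transitivity (\sum_(k <- msupp f) (if [forall i in B, m i == 0%N] then f@_k * (k == m)%:R else 0)).
  apply: eq_bigr => k _; rewrite (linearZZ (restr B)) mcoeffZ /= restrX.
  have [->|km] := eqVneq k m; first by case: ifP => _; rewrite ?mcoeffX ?eqxx ?mcoeff0 ?mulr0.
  by case: ifP => _; rewrite ?mcoeffX ?(negbTE km) ?mcoeff0 mulr0 if_same.
case: ifP => _; last by rewrite big1.
rewrite [f in RHS]mpolyE raddf_sum /=.
by apply: eq_bigr => k _; rewrite mcoeffZ mcoeffX.
Qed.

Lemma restr_id B f :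
  (forall m, m \in msupp f -> forall i, i \in B -> m i = 0%N) -> restr B f = f.
Proof.
move=> fB; apply/mpolyP => m; rewrite mcoeff_restr; case: ifP => // /negbT.
case/forall_inPn => i iB mi0; apply/esym/memN_msupp_eq0; apply/negP => /fB /(_ i iB) mi.
by rewrite mi in mi0.
Qed.

Lemma restr_idP B f m i : restr B f = f -> m \in msupp f -> i \in B -> m i = 0%N.
Proof.
move=> <-; rewrite mcoeff_msupp mcoeff_restr; case: ifP => [/'forall_implyP H _ iB|]; last by rewrite eqxx.
exact/eqP/H.
Qed.

Lemma restr0P B f m : restr B f = 0 -> m \in msupp f -> exists2 i, i \in B & m i != 0%N.
Proof.
move=> f0; rewrite mcoeff_msupp; have := congr1 (mcoeff m) f0.
rewrite mcoeff_restr mcoeff0; case: ifP => [_ ->|/negbT]; first by rewrite eqxx.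
by case/forall_inPn => i iB mi0 _ _; exists i.
Qed.

Lemma restr_restr B C f : restr B (restr C f) = restr (B :|: C) f.
Proof.
apply/mpolyP => m; rewrite !mcoeff_restr.
have -> : [forall i in B :|: C, m i == 0%N] =
          [forall i in B, m i == 0%N] && [forall i in C, m i == 0%N].
  apply/idP/andP => [/'forall_implyP H|[/'forall_implyP HB /'forall_implyP HC]].
    by split; apply/forall_inP => i iB; apply: H; rewrite inE iB ?orbT.
  by apply/'forall_implyP => i; rewrite inE => /orP[/HB|/HC].
by case: [forall i in B, _]; case: [forall i in C, _].
Qed.

Lemma dhomog_restr B d f : f \is d.-homog -> restr B f \is d.-homog.
Proof.
move=> /dhomogP fd; apply/dhomogP => m; rewrite mcoeff_msupp mcoeff_restr.
by case: ifP => _; rewrite ?eqxx // -mcoeff_msupp => /fd.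
Qed.

End Restriction.

(** * Homogeneous components *)

Section Homogeneous.
Variables (K : fieldType) (n : nat).
Implicit Types (g : 'M[K]_n) (f : {mpoly K[n]}).

Lemma hcompE d f : hcomp d f = pihomog mdeg d f. Proof. by []. Qed.

Lemma mcoeff_pihomog d f m : (pihomog mdeg d f)@_m = if mdeg m == d then f@_m else 0.
Proof.
rewrite [f in LHS]mpolyE (linear_sum (pihomog mdeg d)) raddf_sum /=.
transitivity (\sum_(k <- msupp f) (if mdeg m == d then f@_k * (k == m)%:R else 0)).
  apply: eq_bigr => k _; rewrite (linearZZ (pihomog mdeg d)) mcoeffZ /= pihomogX.
  have [->|km] := eqVneq k m; first by case: ifP => _; rewrite ?mcoeffX ?eqxx ?mcoeff0 ?mulr0.
  by case: ifP => _; rewrite ?mcoeffX ?(negbTE km) ?mcoeff0 mulr0 if_same.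
case: ifP => _; last by rewrite big1.
rewrite [f in RHS]mpolyE raddf_sum /=.
by apply: eq_bigr => k _; rewrite mcoeffZ mcoeffX.
Qed.

(** Split f into its homogeneous components: [phi] keeps each in its degree, so only the one of
    degree d survives the projection. *)
Lemma pihomog_comm (phi : {linear {mpoly K[n]} -> {mpoly K[n]}}) d f :
  (forall e p, p \is e.-homog -> phi p \is e.-homog) ->
  pihomog mdeg d (phi f) = phi (pihomog mdeg d f).
Proof.
move=> phi_homog; rewrite {1}(pihomog_partitionE (leqnn (mmeasure mdeg f))).
rewrite (linear_sum phi) (linear_sum (pihomog mdeg d)) /=.
have hom e := phi_homog e _ (pihomogP mdeg e f).
have [d_lt|d_ge] := ltnP d (msize f).
  rewrite (bigD1 (Ordinal d_lt)) //= big1 ?addr0 => [|e ne].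
    exact: pihomog_dE.
  exact: (pihomog_ne0 ne (hom e)).
rewrite big1 => [|e _]; last first.
  by apply: (pihomog_ne0 _ (hom e)); rewrite neq_ltn (leq_trans (ltn_ord e) d_ge).
suff -> : pihomog mdeg d f = 0 by rewrite linear0.
apply/mpolyP => m; rewrite mcoeff_pihomog mcoeff0; case: eqP => // md.
by apply/memN_msupp_eq0/msize_mdeg_ge; rewrite md.
Qed.

Lemma pihomog_restr B d f : pihomog mdeg d (restr B f) = restr B (pihomog mdeg d f).
Proof. by apply: pihomog_comm => e p; apply: dhomog_restr. Qed.

End Homogeneous.

(** * The action of matrices on polynomials *)

Section LinearSubstitution.
Variables (K : fieldType) (n : nat).
Implicit Types (g : 'M[K]_n) (f : {mpoly K[n]}).

HB.instance Definition _ g := GRing.LRMorphism.copy (gact g)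
  (subst (fun i => \sum_(j < n) g i j *: 'X_j)).

Lemma gactXU g i : gact g 'X_i = \sum_(j < n) g i j *: 'X_j.
Proof. exact: substXU. Qed.

Lemma gact_gact g1 g2 f : gact g2 (gact g1 f) = gact (g1 *m g2) f.
Proof.
rewrite /gact -!/(subst _ _) subst_subst; apply: eq_subst => i.
rewrite linear_sum /=.
transitivity (\sum_(j < n) \sum_(k < n) (g1 i j * g2 j k) *: 'X_k : {mpoly K[n]}).
  apply: eq_bigr => j _; rewrite linearZ /= substXU scaler_sumr.
  by apply: eq_bigr => k _; rewrite scalerA.
rewrite exchange_big /=; apply: eq_bigr => k _.
by rewrite mxE scaler_suml.
Qed.

Lemma gact1 f : gact 1%:M f = f.
Proof.
rewrite -[RHS]subst_id; apply: eq_subst => i.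
rewrite (bigD1 i) //= big1 ?addr0 ?mxE ?eqxx ?scale1r // => j ji.
by rewrite mxE eq_sym (negbTE ji) scale0r.
Qed.

Lemma gactK g : g \in unitmx -> cancel (gact g) (gact (invmx g)).
Proof. by move=> gU f; rewrite gact_gact mulmxV // gact1. Qed.

Lemma gactVK g : g \in unitmx -> cancel (gact (invmx g)) (gact g).
Proof. by move=> gU f; rewrite gact_gact mulVmx // gact1. Qed.

Lemma dhomog_prodX d (I : Type) (r : seq I) (P : pred I) (F : I -> {mpoly K[n]})
  (e : I -> nat) : (forall i, F i \is d.-homog) ->
  \prod_(i <- r | P i) F i ^+ e i \is (d * \sum_(i <- r | P i) e i)%N.-homog.
Proof.
move=> Fd; elim: r => [|i r IH]; first by rewrite !big_nil muln0; exact: dhomog1.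
rewrite !big_cons; case: ifP => // _; rewrite mulnDr; apply: dhomogM => //.
exact: dhomogMn.
Qed.

Lemma dhomog_gact g d f : f \is d.-homog -> gact g f \is d.-homog.
Proof.
move=> fd; rewrite /gact -/(subst _ _) substE big_seq.
apply: rpred_sum => m mf; apply: rpredZ.
have <- : (1 * \sum_(i < n) m i)%N = d.
  by rewrite mul1n -mdegE; exact: (dhomog_mf fd mf).
apply: dhomog_prodX => i; apply: rpred_sum => j _; apply: rpredZ.
by rewrite dhomogX /= mdeg1.
Qed.

Lemma pihomog_gact g d f : pihomog mdeg d (gact g f) = gact g (pihomog mdeg d f).
Proof. by apply: pihomog_comm => e p; apply: dhomog_gact. Qed.

End LinearSubstitution.

(** * Noether normalization step *)

(** Additive induction that remembers that the monomials come from the support of f, so bounds on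
    their degree or weight remain available. *)
Lemma mpoly_msupp_ind (K : fieldType) (n : nat) (P : {mpoly K[n]} -> Prop) (f : {mpoly K[n]}) :
  P 0 -> (forall p q, P p -> P q -> P (p + q)) ->
  (forall c m, m \in msupp f -> P (c *: 'X_[m])) -> P f.
Proof.
move=> P0 PD PX; rewrite [f]mpolyE.
have: {subset msupp f <= msupp f} by [].
elim: {1 3}(msupp f) => [|m s IH] sf; first by rewrite big_nil.
rewrite big_cons; apply: PD; first by apply/PX/sf; rewrite inE eqxx.
by apply: IH => k ks; apply: sf; rewrite inE ks orbT.
Qed.

(** * Ideals and their images under matrices; finiteness and independence *)

Section IdealTheory.
Variables (K : fieldType) (n : nat).
Implicit Types (J : polyset K n) (f : {mpoly K[n]}).

Lemma is_ideal0 J : is_ideal J -> J 0. Proof. by case. Qed.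
Lemma is_idealD J : is_ideal J -> forall f g, J f -> J g -> J (f + g). Proof. by case. Qed.
Lemma is_idealMl J : is_ideal J -> forall f g, J f -> J (g * f). Proof. by case. Qed.
Lemma is_idealMr J : is_ideal J -> forall f g, J f -> J (f * g).
Proof. by move=> JI f g Jf; rewrite mulrC; apply: is_idealMl. Qed.
Lemma is_idealZ J : is_ideal J -> forall c f, J f -> J (c *: f).
Proof. by move=> JI c f Jf; rewrite -mul_mpolyC; apply: is_idealMl. Qed.
Lemma is_idealN J : is_ideal J -> forall f, J f -> J (- f).
Proof. by move=> JI f Jf; rewrite -scaleN1r; apply: is_idealZ. Qed.
Lemma is_idealB J : is_ideal J -> forall f g, J f -> J g -> J (f - g).
Proof. by move=> JI f g Jf Jg; apply: is_idealD => //; apply: is_idealN. Qed.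
Lemma is_ideal_sum J (T : Type) (r : seq T) (P : pred T) (F : T -> {mpoly K[n]}) :
  is_ideal J -> (forall t, P t -> J (F t)) -> J (\sum_(t <- r | P t) F t).
Proof.
by move=> JI JF; apply: (big_ind J) => //; [exact: is_ideal0 | exact: is_idealD].
Qed.

Lemma gact_setP J (g : 'M[K]_n) f : g \in unitmx ->
  gact_set g J f <-> J (gact (invmx g) f).
Proof.
move=> gU; split=> [[p [Jp ->]]|Jf]; first by rewrite gactK.
by exists (gact (invmx g) f); rewrite gactVK.
Qed.

Lemma gact_set_ideal J (g : 'M[K]_n) : is_ideal J -> g \in unitmx -> is_ideal (gact_set g J).
Proof.
move=> JI gU; split=> [|f p|f p]; rewrite !gact_setP ?linear0 //; first exact: is_ideal0.
  by rewrite linearD; apply: is_idealD.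
by rewrite rmorphM; apply: is_idealMl.
Qed.

Lemma gact_set_graded J (g : 'M[K]_n) : is_graded J -> g \in unitmx -> is_graded (gact_set g J).
Proof.
move=> [JI JG] gU; split; first exact: gact_set_ideal.
move=> f; rewrite gact_setP // => Jf d.
by rewrite gact_setP // hcompE -pihomog_gact; apply: JG.
Qed.

Lemma gact_set_gact_set J (g1 g2 : 'M[K]_n) f :
  gact_set (g1 *m g2) J f <-> gact_set g2 (gact_set g1 J) f.
Proof.
split=> [[p [Jp ->]]|[_ [[p [Jp ->]] ->]]].
  by exists (gact g1 p); rewrite gact_gact; split=> //; exists p.
by exists p; rewrite gact_gact.
Qed.

(* Some power of every variable lies in J + (x_B); for graded J this makes K[x]/J
   a finite K[x_B]-module. *)
Definition finite_over J (B : {set 'I_n}) : Prop :=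
  exists N, forall i, exists2 phi, J phi & restr B phi = restr B ('X_i ^+ N).

(* [restr (~: B) f = f] says that f lies in K[x_B]. *)
Definition indep_mod J (B : {set 'I_n}) : Prop := forall f, J f -> restr (~: B) f = f -> f = 0.

Lemma finite_over_sub J J' B :
  (forall f, J f -> J' f) -> finite_over J B -> finite_over J' B.
Proof.
by move=> JJ' [N H]; exists N => i; have [phi Jphi e] := H i; exists phi; first exact: JJ'.
Qed.

Lemma finite_over_gt0 J B : is_ideal J -> finite_over J B ->
  exists N, forall i, exists2 phi, J phi & restr B phi = restr B ('X_i ^+ N.+1).
Proof.
move=> JI [N H]; exists N => i; have [phi Jphi e] := H i.
exists (phi * 'X_i); first exact: is_idealMr.
by rewrite rmorphM /= e -rmorphM exprSr.
Qed.

End IdealTheory.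

(** Induction on n: as a polynomial in the last variable, p has a nonzero coefficient; a point where
    it does not vanish leaves a nonzero univariate polynomial, which has a nonroot over a closed
    field. *)
Lemma mpoly_nonroot (K : closedFieldType) (n : nat) (p : {mpoly K[n]}) :
  p != 0 -> exists v : 'I_n -> K, p.@[v] != 0.
Proof.
elim: n p => [|n IH] p p0.
  exists (fun=> 0); rewrite [p]nvar0_mpolyC mevalC; apply: contra p0 => /eqP p0.
  by rewrite [p]nvar0_mpolyC p0 mpolyC0.
pose w := widen_ord (leqnSn n).
have mE (m m' : 'X_{1..n.+1}) : [multinom m (w i) | i < n] = [multinom m' (w i) | i < n] ->
    m ord_max = m' ord_max -> m = m'.
  move=> /mnmP e1 e2; apply/mnmP => i; case: (unliftP ord_max i) => [j ->|-> //].
  by have := e1 j; rewrite !mnmE; congr (m _ = m' _); apply/val_inj; rewrite /= /bump leqNgt ltn_ord.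
have [m mp] : exists m, m \in msupp p.
  by exists (mlead p); apply: mlead_supp.
(* By [mE] no other monomial of p contributes to the same place, so [p@_m] cannot cancel. *)
have q0 : (muni p)`_(m ord_max) != 0.
  apply/eqP => /(congr1 (mcoeff [multinom m (w i) | i < n])); rewrite mcoeff0.
  rewrite muniE coef_sum raddf_sum (bigD1_seq m) //= big1_seq ?addr0.
    rewrite coefZ coefXn eqxx mulr1 mcoeffZ mcoeffX eqxx mulr1 => /eqP.
    by rewrite mcoeff_eq0 mp.
  move=> k /andP[km _]; rewrite coefZ coefXn.
  case: eqP => [e|_]; last by rewrite mulr0 mcoeff0.
  rewrite mulr1 mcoeffZ mcoeffX; case: eqP => [e'|]; last by rewrite mulr0.
  by rewrite (mE _ _ e' (esym e)) eqxx in km.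
have [v qv] := IH _ q0.
pose q := map_poly (meval v) (muni p).
have /closed_nonrootP [t qt] : q != 0.
  by apply: contraNneq qv => /(congr1 (coefp (m ord_max))); rewrite /= coef0 coef_map /= => ->.
exists (fun i => if unlift ord_max i is Some j then v j else t).
suff -> : p.@[fun i => if unlift ord_max i is Some j then v j else t] = q.[t] by [].
rewrite /q muniE [p in LHS]mpolyE raddf_sum /= rmorph_sum /= horner_sum.
apply: eq_bigr => k _; rewrite mevalZ mevalX -!mul_polyC !rmorphM /= map_polyC /= map_polyXn.
rewrite hornerM hornerC hornerXn mevalZ mevalX -mulrA; congr (_ * _).
rewrite big_ord_recr /= unlift_none; congr (_ * _); apply: eq_bigr => i _.
rewrite mnmE; have -> : widen_ord (leqnSn n) i = lift ord_max i.
  by apply/val_inj; rewrite /= /bump leqNgt ltn_ord.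
by rewrite liftK.
Qed.

Section NoetherNormalization.
Variables (K : closedFieldType) (n : nat).
Implicit Types (J : polyset K n) (B : {set 'I_n}).

(** Classical normalization by a linear change: take a homogeneous component G of F and a point c
    with G(c) nonzero, and turn c into a coordinate direction, so that x_b becomes nilpotent modulo
    the new ideal and the other variables of B. *)
Lemma finite_over_step J B F :
  is_graded J -> ~ J 1 -> finite_over J B -> J F -> restr (~: B) F = F -> F != 0 ->
  exists2 b, b \in B & exists2 g : 'M[K]_n, g \in unitmx & finite_over (gact_set g J) (B :\ b).
Proof.
move=> [JI JG] J1 finJ JF FB F0.
have [d Fd0] : exists d, pihomog mdeg d F != 0.
  exists (mdeg (mlead F)); apply/eqP => /(congr1 (mcoeff (mlead F))) /eqP.
  by rewrite mcoeff_pihomog eqxx mcoeff0 mleadc_eq0 (negbTE F0).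
pose G := pihomog mdeg d F; have JGd : J G by apply: JG.
have GB : restr (~: B) G = G by rewrite -pihomog_restr FB.
have Gd : {in msupp G, forall m, mdeg m = d} by apply/dhomogP/pihomogP.
have Gsupp m i : m \in msupp G -> i \notin B -> m i = 0%N.
  by move=> mG iB; apply: (restr_idP GB mG); rewrite inE.
have [c Gc] := mpoly_nonroot Fd0.
(* A nonzero component of degree 0 would be a unit in J. *)
have d_gt0 : (0 < d)%N.
  case: (posnP d) => // d0; case: J1.
  have GE : G = (G@_0)%:MP.
    apply/mpolyP => m; rewrite mcoeffC; have [->|m0] := eqVneq m 0%MM; first by rewrite mulr1.
    rewrite mulr0; apply/memN_msupp_eq0; apply: contraNN m0 => /Gd.
    by rewrite d0 => /eqP; rewrite mdeg_eq0.
  have G00 : G@_0 != 0 by apply: contraNneq Fd0 => e; rewrite -/G GE e mpolyC0.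
  by have := is_idealZ JI (G@_0)^-1 JGd; rewrite GE -mul_mpolyC mcoeffC eqxx mulr1 -mpolyCM mulVf.
(* G has positive degree and involves only x_B, so it vanishes wherever all B-coordinates do. *)
have /exists_inP [b bB cb] : [exists b in B, c b != 0].
  apply: contraNT Gc; rewrite negb_exists_in => /'forall_implyP c0.
  rewrite mevalE big_seq big1 // => m mG.
  have [i mi] : exists i, m i != 0%N.
    apply/existsP; apply: contraTT d_gt0; rewrite negb_exists => /forallP m0.
    by rewrite -(Gd m mG) mdegE big1 // => i _; apply/eqP; rewrite -[_ == _]negbK.
  have iB : i \in B by apply: contraNT mi => iB; rewrite (Gsupp m i).
  have /eqP ci : c i == 0 by rewrite -[_ == _]negbK c0.
  by rewrite (bigD1 i) //= ci expr0n (negbTE mi) mul0r mulr0.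
exists b => //.
(* h adds c_i x_b to x_i for i in B, so that hG has leading term G(c) x_b^d. *)
pose v := \col_i ((if i \in B then c i else 0) - (i == b)%:R) : 'cV[K]_n.
pose h := 1%:M + v *m delta_mx 0 b.
have hE i j : h i j = (i == j)%:R + v i 0 * (j == b)%:R.
  by rewrite /h mxE [_%:M i j]mxE [(v *m _) i j]mxE big_ord1 [delta_mx _ _ _ _]mxE eqxx.
have hU : h \in unitmx.
  (* [h] is a rank-one update of the identity with 1 + v_b = c_b; this is the Sherman-Morrison
     inverse. *)
  suff /mulmx1_unit [] : h *m (1%:M - (c b)^-1 *: (v *m delta_mx 0 b)) = 1%:M by [].
  rewrite mulmxBr mulmx1 -scalemxAr mulmxDl mul1mx -mulmxA (mulmxA _ v).
  have -> : delta_mx 0 b *m v = (c b - 1)%:M :> 'M_1.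
    apply/matrixP => i j; rewrite !ord1 !mxE (bigD1 b) //= big1 ?addr0 => [|k kb].
      by rewrite !mxE !eqxx bB mul1r.
    by rewrite !mxE (negbTE kb) andbF mul0r.
  rewrite mul_scalar_mx -scalemxAr -{1}[v *m delta_mx 0 b]scale1r -scalerDl.
  by rewrite addrCA subrr addr0 scalerA mulVf // scale1r addrK.
exists h => //.
(* Modulo the variables of [B :\ b], the change [h] restricts x_B to the line spanned by c, with
   parameter x_b. *)
pose psi := subst (fun j => if j \in B then c j *: 'X_b else 'X_j).
have psiE f : restr (B :\ b) (gact h f) = psi f.
  rewrite /restr /gact -/(subst _ _) subst_subst; apply: eq_subst => i.
  rewrite linear_sum /=; under eq_bigr => j _ do rewrite linearZ /= substXU hE.
  have [iB|iB] := boolP (i \in B); last first.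
    have ib : i != b by apply: contraNneq iB => ->.
    have vi : v i 0 = 0 by rewrite mxE (negbTE iB) (negbTE ib) subrr.
    rewrite (bigD1 i) //= vi big1 => [|j ji].
      by rewrite eqxx mul0r !addr0 scale1r in_setD1 (negbTE iB) andbF.
    by rewrite eq_sym (negbTE ji) mul0r addr0 scale0r.
  have [ib|ib] := eqVneq i b.
    rewrite ib (bigD1 b) //= big1 => [|j jb].
      by rewrite in_setD1 !eqxx mxE -ib iB eqxx mulr1 addr0 addrCA subrr addr0.
    by rewrite eq_sym (negbTE jb) mulr0 addr0 scale0r.
  have vi : v i 0 = c i by rewrite mxE iB (negbTE ib) subr0.
  rewrite (bigD1 b) //= vi eqxx (negbTE ib) in_setD1 eqxx /= add0r mulr1.
  rewrite (bigD1 i) //= eqxx (negbTE ib) mulr0 addr0 in_setD1 ib iB scaler0 add0r.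
  rewrite big1 ?addr0 // => j /andP[jb ji].
  by rewrite eq_sym (negbTE ji) (negbTE jb) mulr0 addr0 scale0r.
have psiG : psi G = G.@[c] *: 'X_b ^+ d.
  rewrite /psi substE mevalE scaler_suml !big_seq; apply: eq_bigr => m mG.
  rewrite -scalerA; congr (_ *: _).
  transitivity (\prod_(i < n) (c i ^+ m i *: 'X_b ^+ m i) : {mpoly K[n]}).
    apply: eq_bigr => i _; have [iB|iB] := boolP (i \in B); first by rewrite exprZn.
    by rewrite (Gsupp m i) // !expr0 scale1r.
  rewrite scaler_prod; congr (_ *: _).
  by rewrite prodrXr -(Gd m mG) mdegE.
have psi0 q : restr B q = 0 -> exists r, psi q = 'X_b * restr (B :\ b) r.
  move=> q0; apply: (@mpoly_msupp_ind _ _ (fun p => exists r, psi p = 'X_b * restr (B :\ b) r)).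
  - by exists 0; rewrite /psi !linear0 mulr0.
  - by move=> p1 p2 [r1 e1] [r2 e2]; exists (r1 + r2); rewrite linearD mulrDr -e1 -e2 /psi linearD.
  move=> a m mq; have [i iB mi] := restr0P q0 mq.
  have -> : m = (U_(i) + (m - U_(i)))%MM by rewrite addmC submK // lep1mP.
  exists (a *: (c i *: gact h 'X_[m - U_(i)])).
  rewrite mpolyXD /psi !linearZ /= psiE /psi rmorphM /= substXU iB.
  by rewrite -scalerAl -!scalerAr.
have Xb : restr (K := K) (B :\ b) 'X_b = 'X_b by rewrite restrXU in_setD1 eqxx.
pose Gh := (G.@[c])^-1 *: gact h G.
have JGh : gact_set h J Gh by apply: is_idealZ; [exact: gact_set_ideal | exists G].
have Ghb : restr (B :\ b) Gh = 'X_b ^+ d.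
  by rewrite linearZ /= psiE psiG scalerA mulVf // scale1r.
have JhI := gact_set_ideal JI hU.
have [M HM] := finite_over_gt0 JI finJ.
(* For i outside B, x_i^(M+1) is a multiple of x_b modulo the new ideal and the variables of
   [B :\ b]; its d-th power is then a multiple of x_b^d, which [Gh] removes. *)
exists (M.+1 * d)%N => i.
have [iB|iB] := boolP (i \in B).
  have [->|ib] := eqVneq i b; last first.
    exists 0; first exact: is_ideal0.
    rewrite linear0 rmorphXn /= restrXU in_setD1 iB ib /= expr0n.
    by rewrite -(prednK d_gt0) muln_eq0.
  exists (Gh * 'X_b ^+ (M * d)); first exact: is_idealMr.
  by rewrite rmorphM !rmorphXn /= Ghb Xb -exprD.
have [phi Jphi phiE] := HM i.
have [r rE] : exists r, psi (phi - 'X_i ^+ M.+1) = 'X_b * restr (B :\ b) r.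
  by apply: psi0; rewrite linearB /= phiE subrr.
have Xi : restr (K := K) (B :\ b) 'X_i = 'X_i by rewrite restrXU in_setD1 (negbTE iB) andbF.
have psiphi : psi phi = 'X_i ^+ M.+1 + 'X_b * restr (B :\ b) r.
  rewrite -rE /psi linearB /= rmorphXn /= substXU (negbTE iB).
  by rewrite addrCA subrr addr0.
pose S (a e : {mpoly K[n]}) := \sum_(k < d) a ^+ (d.-1 - k) * (- e) ^+ k.
have SE a e : a ^+ d = (a + e) * S a e + (- e) ^+ d.
  by rewrite -[LHS](subrK ((- e) ^+ d)) subrXX opprK.
(* With a = x_i^(M+1) and e = x_b r, the first product restricts to a^d - (-e)^d and the second to
   (-e)^d. *)
exists (gact h phi * S ('X_i ^+ M.+1) ('X_b * r) + (- r) ^+ d * Gh).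
  by apply: is_idealD => //; [apply: is_idealMr => //; exists phi | apply: is_idealMl].
rewrite linearD /= !rmorphM /= psiE psiphi exprM !rmorphXn /= Xi [in RHS](SE _ ('X_b * restr (B :\ b) r)).
congr (_ * _ + _); last by rewrite Ghb linearN /= -mulrN exprMn mulrC.
rewrite /S linear_sum; apply: eq_bigr => k _.
by rewrite rmorphM /= !rmorphXn /= rmorphN /= rmorphM /= Xi Xb.
Qed.

End NoetherNormalization.

(** * Reduction modulo an ideal and counting *)

Section Reduction.
Variables (K : fieldType) (n : nat).
Implicit Types (J : polyset K n) (B : {set 'I_n}) (f : {mpoly K[n]}).

Lemma ideal_reduce_lin J (Q : 'X_{1..n} -> Prop) f : is_ideal J ->
  (forall m, m \in msupp f ->
    exists2 c, J ('X_[m] - c) & forall k, k \in msupp c -> Q k) ->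
  exists2 c, J (f - c) & forall k, k \in msupp c -> Q k.
Proof.
move=> JI H; apply: (@mpoly_msupp_ind _ _ (fun p => exists2 c, J (p - c) &
    forall k, k \in msupp c -> Q k)).
- by exists 0 => [|k]; rewrite ?subr0 ?msupp0 //; apply: is_ideal0.
- move=> p q [c Jc cQ] [c' Jc' c'Q]; exists (c + c') => [|k].
    by rewrite opprD addrACA; apply: is_idealD.
  by move/msuppD_le; rewrite mem_cat => /orP[/cQ|/c'Q].
- move=> a m /H [c Jc cQ]; exists (a *: c) => [|k /msuppZ_le/cQ //].
  by rewrite -scalerBr; apply: is_idealZ.
Qed.

(** Rewrite x_i^(N+1), for i outside B, by a form of the same degree each of whose terms contains a
    variable of B: the degree in the variables outside B drops while the total degree stays. *)
Lemma reduce_monomial J B : is_graded J -> finite_over J B ->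
  exists N, forall m, exists2 c, J ('X_[m] - c) &
    forall k, k \in msupp c -> mdeg k = mdeg m /\ forall i, i \notin B -> (k i < N.+1)%N.
Proof.
move=> [JI JG] /(finite_over_gt0 JI) [N HN]; exists N => m.
pose off (k : 'X_{1..n}) := (\sum_(i | i \notin B) k i)%N.
have [t] := ubnP (off m); elim: t m => // t IH m; rewrite ltnS => mt.
have [/forall_inP mN|] := boolP [forall i in ~: B, m i < N.+1]%N.
  exists 'X_[m]; first by rewrite subrr; apply: is_ideal0.
  move=> k /mem_msuppXP <-; split=> // i iB; apply: mN; by rewrite inE.
case/forall_inPn => i; rewrite inE => iB; rewrite -leqNgt => mi.
have [phi0 Jphi0 phi0E] := HN i.
(* The component of degree N + 1 has the same restriction, and it makes the rewriting preserve total
   degree. *)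
pose phi := pihomog mdeg N.+1 phi0; have Jphi : J phi by apply: JG.
have XN : 'X_i ^+ N.+1 \is [in K[n], (N.+1).-homog].
  by rewrite mpolyXn dhomogX /= mdegMn mdeg1 mul1n.
have phiE : restr B phi = restr B ('X_i ^+ N.+1).
  by rewrite -pihomog_restr phi0E pihomog_restr pihomog_dE.
pose q : {mpoly K[n]} := 'X_i ^+ N.+1 - phi.
have q_hom : q \is (N.+1).-homog by apply: rpredB => //; apply: pihomogP.
have q0 : restr B q = 0 by rewrite linearB /= phiE subrr.
have lem : (U_(i) *+ N.+1 <= m)%MM.
  by apply/mnm_lepP => j; rewrite mulmnE mnm1E; case: eqP => [<-|_]; rewrite ?mul1n ?mul0n.
pose m' := (m - U_(i) *+ N.+1)%MM.
have mE : m = (m' + U_(i) *+ N.+1)%MM by rewrite submK.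
have red : exists2 c, J ('X_[m'] * q - c) &
    forall k, k \in msupp c -> mdeg k = mdeg m /\ forall j, j \notin B -> (k j < N.+1)%N.
  apply: ideal_reduce_lin => // k.
  rewrite mulrC (perm_mem (msuppMX _ _)) => /mapP [kq kq_in ->].
  have [c Jc cP] : exists2 c, J ('X_[m' + kq] - c) & forall k, k \in msupp c ->
      mdeg k = mdeg (m' + kq) /\ forall j, j \notin B -> (k j < N.+1)%N.
    apply: IH; apply: leq_trans mt.
    have offD k1 k2 : off (k1 + k2)%MM = (off k1 + off k2)%N.
      by rewrite /off -big_split; apply: eq_bigr => j _; rewrite mnmDE.
    rewrite mE !offD ltn_add2l.
    have -> : off (U_(i) *+ N.+1)%MM = N.+1.
      rewrite /off (bigD1 i) //= mulmnE mnm1E eqxx mul1n big1 ?addn0 // => j /andP[_ ji].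
      by rewrite mulmnE mnm1E eq_sym (negbTE ji).
    have [j jB kj] := restr0P q0 kq_in.
    have <- : mdeg kq = N.+1 by exact: (dhomog_mf q_hom kq_in).
    rewrite mdegE (bigID (mem B)) /= -[X in (X < _)%N]add0n ltn_add2r.
    by rewrite (bigD1 j) //= addn_gt0 lt0n kj.
  exists c => //.
  move=> k' /cP [-> H]; split=> //.
  by rewrite mE !mdegD (dhomog_mf q_hom kq_in) mdegMn mdeg1 mul1n.
have [c Jc cP] := red; exists c => //.
have -> : 'X_[m] - c = 'X_[m'] * phi + ('X_[m'] * q - c).
  by rewrite addrA -mulrDr addrC -[phi in X in _ = X](subrK phi) /q mE mpolyXD -mpolyXn; ring.
by apply: is_idealD => //; apply: is_idealMl.
Qed.

(** K[x]/J is a finite K[x_B]-module. Unlike [finite_over], this has the right meaning also for the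
    non-graded ideals met in prime chains. *)
Definition fingen J B : Prop := exists r (b : 'I_r -> {mpoly K[n]}), forall f,
  exists2 s : 'I_r -> {mpoly K[n]},
    forall e, restr (~: B) (s e) = s e & J (f - \sum_e s e * b e).

Lemma finite_over_fingen J B : is_graded J -> finite_over J B -> fingen J B.
Proof.
move=> JG finJ; have [JI _] := JG; have [N HN] := reduce_monomial JG finJ.
(* The generators are the monomials in the variables outside B with exponents at most N; entries of
   an index at B are ignored, so generators may repeat. *)
pose T : finType := {ffun 'I_n -> 'I_N.+1}.
exists #|T|, (fun e => 'X_[[multinom if i \in B then 0%N else (enum_val e : T) i : nat | i < n]]).
move=> f.
have [c Jc cN] : exists2 c, J (f - c) &
    forall k, k \in msupp c -> forall i, i \notin B -> (k i < N.+1)%N.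
  apply: ideal_reduce_lin => // m _; have [c Jc cP] := HN m.
  by exists c => // k /cP [].
suff [s sB cE] : exists2 s : 'I_#|T| -> {mpoly K[n]}, forall e, restr (~: B) (s e) = s e &
    c = \sum_e s e * 'X_[[multinom if i \in B then 0%N else (enum_val e : T) i : nat | i < n]].
  by exists s => //; rewrite -cE.
apply: (@mpoly_msupp_ind _ _ (fun p => exists2 s : 'I_#|T| -> {mpoly K[n]},
  forall e, restr (~: B) (s e) = s e & p = \sum_e s e * _)).
- by exists (fun=> 0) => [e|]; rewrite ?linear0 // big1 // => e _; rewrite mul0r.
- move=> p q [s sB ->] [s' sB' ->]; exists (fun e => s e + s' e) => [e|].
    by rewrite linearD /= sB sB'.
  by rewrite -big_split; apply: eq_bigr => e _; rewrite mulrDl.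
move=> a k /cN kN; pose x : T := [ffun i => inord (k i)].
exists (fun e => if e == enum_rank x then a *: 'X_[[multinom if i \in B then k i else 0%N | i < n]]
    else 0) => [e|].
  case: ifP => _; last by rewrite linear0.
  rewrite linearZ /= restr_id // => m /mem_msuppXP <- i.
  by rewrite inE mnmE => /negbTE ->.
rewrite (bigD1 (enum_rank x)) //= big1 ?addr0 => [|e /negbTE ->]; last by rewrite mul0r.
rewrite eqxx -scalerAl -mpolyXD; congr (_ *: 'X_[_]); apply/mnmP => i.
rewrite mnmDE !mnmE enum_rankK ffunE; case: ifP => iB; first by rewrite addn0.
by rewrite inordK // kN ?iB.
Qed.

End Reduction.

(** * Bounding the length of prime chains by counting *)

Section Counting.
Variables (K : fieldType) (n : nat).
Implicit Types (J : polyset K n) (B : {set 'I_n}) (f : {mpoly K[n]}).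

Let deg_le f d := forall m, m \in msupp f -> (mdeg m <= d)%N.

Let deg_leM f g d e : deg_le f d -> deg_le g e -> deg_le (f * g) (d + e).
Proof.
move=> fd ge m /msuppM_le /allpairsP [[m1 m2] /= [/fd h1 /ge h2 ->]].
by rewrite mdegD leq_add.
Qed.

Let deg_leX f d k : deg_le f d -> deg_le (f ^+ k) (k * d).
Proof.
move=> fd; elim: k => [|k IH]; last by rewrite exprS mulSn; apply: deg_leM.
by move=> m; rewrite msupp1 inE => /eqP ->; rewrite mdeg0.
Qed.

(** Take f in P_1 but not in P_0 and, by induction, v_t independent modulo P_1; then the f^j v_t
    with j < s are independent modulo P_0. In a relation, reduction modulo P_1 kills the
    coefficients with j = 0, and primality of P_0 allows division of the rest by f. *)
Lemma chain_lin_indep k (P : nat -> polyset K n) :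
  (forall j, (j <= k)%N -> is_prime (P j)) ->
  (forall j, (j < k)%N -> (forall f, P j f -> P j.+1 f) /\ exists f, P j.+1 f /\ ~ P j f) ->
  exists e, forall s, exists (T : finType) (v : T -> {mpoly K[n]}),
    [/\ #|T| = (s ^ k)%N,
        forall t m, m \in msupp (v t) -> (mdeg m <= s * e)%N &
        forall c : T -> K, P 0%N (\sum_t c t *: v t) -> forall t, c t = 0].
Proof.
elim: k P => [|k IH] P prP ltP.
  exists 0%N => s; exists unit, (fun=> 1); split; first by rewrite card_unit.
    by move=> t m; rewrite msupp1 inE => /eqP ->; rewrite mdeg0.
  have [PI P1 _] := prP 0%N isT.
  move=> c Pc []; apply/eqP/negPn/negP => ct; apply: P1.
  have := is_idealZ PI (c tt)^-1 Pc; rewrite (big_pred1 tt); last by case.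
  by rewrite scalerA mulVf // scale1r.
have [e He] := IH (fun j => P j.+1) (fun j => prP j.+1) (fun j => ltP j.+1).
have [P01 [f [P1f nP0f]]] := ltP 0%N isT.
have [P0I _ P0pr] := prP 0%N isT; have [P1I _ _] := prP 1%N isT.
exists (e + msize f)%N => s; have [T [v [cT dv iv]]] := He s.
exists ('I_s * T)%type, (fun x : 'I_s * T => f ^+ x.1 * v x.2); split.
- by rewrite card_prod card_ord cT expnS.
- move=> [j t] /=; rewrite addnC mulnDr; refine (deg_leM _ (dv t)).
  move=> m' /(deg_leX (d := msize f)) h; apply: leq_trans (h _) _.
    by move=> m2 /msize_mdeg_lt /ltnW.
  by rewrite leq_mul2r ltnW ?orbT.
move=> c.
have -> : \sum_(x : 'I_s * T) c x *: (f ^+ x.1 * v x.2) = \sum_(j < s) f ^+ j * \sum_t c (j, t) *: v t.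
  transitivity (\sum_(j < s) \sum_t c (j, t) *: (f ^+ j * v t)).
    by rewrite pair_bigA; apply: eq_bigr => -[].
  by apply: eq_bigr => j _; rewrite mulr_sumr; apply: eq_bigr => t _; rewrite scalerAr.
(* Coefficients indexed by [nat] permit the shift in the induction on the number of powers of f. *)
suff main s' (d : nat -> T -> K) : P 0%N (\sum_(j < s') f ^+ j * \sum_t d j t *: v t) ->
    forall j t, (j < s')%N -> d j t = 0.
  move=> Pc [j t]; pose d j t := if insub j is Some j' then c (j', t) else 0.
  have dE (i : 'I_s) t' : d i t' = c (i, t') by rewrite /d valK.
  rewrite -dE; apply: main (ltn_ord j); move: Pc; congr (P _ _).
  by apply: eq_bigr => i _; congr (_ * _); apply: eq_bigr => t' _; rewrite dE.
elim: s' d => [|s' IHs] d; first by [].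
rewrite big_ord_recl expr0 mul1r => Pd.
have SE : \sum_(i < s') f ^+ bump 0 i * (\sum_t d (bump 0 i) t *: v t) =
    f * \sum_(i < s') f ^+ i * \sum_t d i.+1 t *: v t.
  by rewrite mulr_sumr; apply: eq_bigr => i _; rewrite exprS mulrA.
rewrite SE in Pd.
have d0 t : d 0%N t = 0.
  apply: (iv (d 0%N)); rewrite -[X in P _ X](addrK (f * \sum_(i < s') f ^+ i * \sum_t d i.+1 t *: v t)).
  by apply: (is_idealB P1I); [apply: P01 | apply: (is_idealMr P1I)].
have {}Pd : P 0%N (f * \sum_(i < s') f ^+ i * \sum_t d i.+1 t *: v t).
  by move: Pd; rewrite big1 ?add0r // => t _; rewrite d0 scale0r.
case: (P0pr _ _ Pd) => // Pd' [|j] t // js.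
exact: (IHs (fun j => d j.+1) Pd').
Qed.

(** Reduction modulo J puts s^k independent polynomials of degree at most s e into the span of at
    most (N+1)^n (s e + 1)^|B| monomials, which is too small if k > |B| and s is large. *)
Theorem prime_chain_le J B k :
  is_graded J -> finite_over J B -> prime_chain J k -> (k <= #|B|)%N.
Proof.
move=> JG finJ [P [prP ltP]]; rewrite leqNgt; apply/negP => Bk.
have [JI _] := JG; have [N HN] := reduce_monomial JG finJ.
have [e He] := chain_lin_indep (fun j h => (prP j h).1) ltP.
have JP f : J f -> P 0%N f := (prP 0%N isT).2 f.
(* This s gives (N+1)^n (s (e+1))^|B| < s^(|B|+1), and s e + 1 <= s (e+1). *)
pose s := (N.+1 ^ n * e.+1 ^ #|B| + 1)%N; pose D := (s * e)%N.
have [T [v [cT dv iv]]] := He s.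
(* Exponents at most N outside B and at most D on B. The first function is ignored on B, so [mon]
   may repeat monomials; only an upper bound is wanted. *)
pose X : finType := ({ffun 'I_n -> 'I_N.+1} * {ffun {i | i \in B} -> 'I_D.+1})%type.
have cXT : (#|X| < #|T|)%N.
  rewrite cT card_prod !card_ffun !card_ord card_sig.
  have -> : #|[pred x | x \in B]| = #|B| by apply: eq_card.
  have De : (D.+1 <= s * e.+1)%N by rewrite /D /s; nia.
  apply: (@leq_ltn_trans (N.+1 ^ n * (s * e.+1) ^ #|B|)).
    by rewrite leq_mul2l; case: #|B| => [|d]; rewrite ?expn0 ?leq_exp2r ?De ?leqnn ?orbT.
  have s_gt0 : (0 < s)%N by rewrite /s addn1.
  apply: (@leq_trans (s ^ #|B|.+1)); last by rewrite leq_pexp2l.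
  by rewrite expnMn mulnCA [X in (_ < X)%N]expnSr ltn_pmul2l ?expn_gt0 ?s_gt0 // /s addn1.
pose mon (x : X) : 'X_{1..n} :=
  [multinom if insub i is Some j then x.2 j : nat else x.1 i : nat | i < n].
have /fin_all_exists [a Ha] t : exists a : X -> K, J (v t - \sum_x a x *: 'X_[mon x]).
  have [c Jc cP] : exists2 c, J (v t - c) &
      forall k, k \in msupp c -> (mdeg k <= D)%N /\ forall i, i \notin B -> (k i < N.+1)%N.
    apply: ideal_reduce_lin => // m /dv mD; have [c Jc cP] := HN m.
    by exists c => // k' /cP [->].
  suff [a ca] : exists a : X -> K, c = \sum_x a x *: 'X_[mon x] by exists a; rewrite -ca.
  apply: (@mpoly_msupp_ind _ _ (fun p => exists a : X -> K, p = \sum_x a x *: 'X_[mon x])).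
  - by exists (fun=> 0); rewrite big1 // => x _; rewrite scale0r.
  - move=> p q [a1 ->] [a2 ->]; exists (fun x => a1 x + a2 x).
    by rewrite -big_split; apply: eq_bigr => x _; rewrite scalerDl.
  move=> a0 m /cP [mD mN].
  pose x : X := ([ffun i => inord (m i)], [ffun i => inord (m (val i))]).
  exists (fun y => if y == x then a0 else 0).
  rewrite (bigD1 x) //= eqxx big1 ?addr0 => [|y /negbTE ->]; last by rewrite scale0r.
  congr (_ *: 'X_[_]); apply/mnmP => i; rewrite mnmE /=; case: insubP => [j _ jE|iB].
    rewrite ffunE inordK ?jE // ltnS (leq_trans _ mD) // mdegE (bigD1 i) //=.
    by rewrite leq_addr.
  by rewrite ffunE inordK // mN.
pose M := \matrix_(i < #|T|, j < #|X|) a (enum_val i) (enum_val j).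
(* More rows than columns: a nonzero row in the left kernel is a relation among the v_t modulo J,
   hence modulo P_0. *)
have : kermx M != 0.
  by rewrite -mxrank_eq0 mxrank_ker subn_eq0 -ltnNge (leq_ltn_trans (rank_leq_col _)).
case/rowV0Pn => u /sub_kermxP uM u0; case/eqP: u0; apply/rowP => i; rewrite mxE.
rewrite -[i]enum_valK; apply: (iv (fun t => u 0 (enum_rank t))).
have S0 : \sum_t u 0 (enum_rank t) *: \sum_x a t x *: 'X_[mon x] = 0.
  under eq_bigr => t _ do rewrite scaler_sumr.
  rewrite exchange_big big1 //= => x _.
  under eq_bigr => t _ do rewrite scalerA.
  rewrite -scaler_suml; suff -> : \sum_t u 0 (enum_rank t) * a t x = 0 by rewrite scale0r.
  have := congr1 (fun A : 'rV_#|X| => A 0 (enum_rank x)) uM.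
  rewrite /= [RHS]mxE mxE => uMx; rewrite -[RHS]uMx (reindex (@enum_val T T)) /=; last by apply: onW_bij; apply: enum_val_bij.
  by apply: eq_bigr => j _; rewrite mxE enum_valK enum_rankK.
apply: JP; rewrite -[X in J X]subr0 -[X in _ - X]S0 -sumrB; apply: is_ideal_sum => // t _; rewrite -scalerBr.
exact: is_idealZ.
Qed.

End Counting.

(** * Prime chains *)

Section Chains.
Variables (K : fieldType) (n : nat).
Implicit Types (J : polyset K n) (B : {set 'I_n}) (f : {mpoly K[n]}).

(** Cayley-Hamilton argument: by the adjugate, det A times every b_k lies in J, and 1 is a
    combination of the b_k modulo J. *)
Lemma fingen_det J r (b s : 'I_r -> {mpoly K[n]}) (A : 'M[{mpoly K[n]}]_r) :
  is_ideal J -> J (1 - \sum_e s e * b e) ->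
  (forall e, J (\sum_e' A e e' * b e')) -> J (\det A).
Proof.
move=> JI J1 JA.
have Jb k : J (\det A * b k).
  have -> : \det A * b k = \sum_e \adj A k e * \sum_e' A e e' * b e'.
    under eq_bigr => e _ do rewrite mulr_sumr.
    rewrite exchange_big /=.
    transitivity (\sum_j (\adj A *m A) k j * b j).
      rewrite mul_adj_mx (bigD1 k) //= big1 ?addr0 => [|j jk]; rewrite mxE ?eqxx //.
      by rewrite eq_sym (negbTE jk) mul0r.
    apply: eq_bigr => j _; rewrite mxE mulr_suml; apply: eq_bigr => e _.
    by rewrite mulrA.
  by apply: is_ideal_sum => // e _; apply: is_idealMl.
rewrite -[\det A]mulr1 -[X in _ * X](subrK (\sum_e s e * b e)) mulrDr.
apply: is_idealD => //; first exact: is_idealMl.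
rewrite mulr_sumr; apply: is_ideal_sum => // e _.
by rewrite mulrCA; apply: is_idealMl.
Qed.

(** The ideal J + (x_b). *)
Definition add_var J (b : 'I_n) : polyset K n := fun f => exists q, J (f - 'X_b * q).

Lemma sub_add_var J b f : J f -> add_var J b f.
Proof. by exists 0; rewrite mulr0 subr0. Qed.

Lemma add_var_ideal J b : is_ideal J -> is_ideal (add_var J b).
Proof.
move=> JI; split=> [|f g [q Jq] [q' Jq']|f g [q Jq]].
- by apply: sub_add_var; apply: is_ideal0.
- by exists (q + q'); rewrite mulrDr opprD addrACA; apply: is_idealD.
by exists (g * q); rewrite mulrCA -mulrBr; apply: is_idealMl.
Qed.

Lemma fingen_sub J J' B : (forall f, J f -> J' f) -> fingen J B -> fingen J' B.
Proof.
move=> JJ' [r [b H]]; exists r, b => f; have [s sB Js] := H f.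
by exists s => //; apply: JJ'.
Qed.

Lemma restr_sub B (C : {set 'I_n}) f : B \subset C -> restr C f = f -> restr B f = f.
Proof. by move=> /setUidPr BC fC; rewrite -{1}fC restr_restr BC. Qed.

(** Setting x_b = 0 in the coefficients changes them by multiples of x_b, which lie in the new
    ideal. *)
Lemma fingen_add_var J B b : is_ideal J -> b \in B -> fingen J B -> fingen (add_var J b) (B :\ b).
Proof.
move=> JI bB [r [v H]]; exists r, v => f; have [s sB Js] := H f.
exists (fun e => restr [set b] (s e)) => [e|].
  rewrite -{2}(sB e) !restr_restr; congr (restr _ _).
  by apply/setP => i; rewrite !inE; case: eqP => [->|_]; rewrite ?bB ?orbT //= orbF.
have -> : f - \sum_e restr [set b] (s e) * v e =
    (f - \sum_e s e * v e) + \sum_e (s e - restr [set b] (s e)) * v e.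
  under [X in _ = _ + X]eq_bigr => e _ do rewrite mulrBl.
  by rewrite sumrB addrA subrK.
have JI' := add_var_ideal b JI.
apply: is_idealD => //; first exact: sub_add_var.
apply: is_ideal_sum => // e _; apply: is_idealMr => //.
have [q ->] : exists q, s e - restr [set b] (s e) = 'X_b * q; last first.
  by exists q; rewrite subrr; apply: is_ideal0.
apply: (@mpoly_msupp_ind _ _ (fun p => exists q, p - restr [set b] p = 'X_b * q)).
- by exists 0; rewrite linear0 subrr mulr0.
- by move=> p p' [q e1] [q' e2]; exists (q + q'); rewrite linearD opprD addrACA e1 e2 mulrDr.
move=> a m _; rewrite linearZ /= restrX; case: ifP => [_|/negbT].
  by exists 0; rewrite subrr mulr0.
case/forall_inPn => i /set1P -> mb; exists (a *: 'X_[m - U_(b)]).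
by rewrite scaler0 subr0 -scalerAr -mpolyXD addmC submK // lep1mP.
Qed.

(** Let h in K[x_(B - b)] be congruent to x_b q modulo J. Multiplication by q has a matrix S over
    K[x_B], so det(h - x_b S) lies in J and in K[x_B] and vanishes; putting x_b = 0 leaves h^r =
    0. *)
Lemma indep_mod_add_var J B b : is_ideal J -> b \in B -> fingen J B ->
  indep_mod J B -> indep_mod (add_var J b) (B :\ b).
Proof.
move=> JI bB [r [v H]] indJ h [q Jq] hB.
have [S HS] : exists S : 'I_r -> 'I_r -> {mpoly K[n]}, forall e,
    (forall e', restr (~: B) (S e e') = S e e') /\ J (q * v e - \sum_e' S e e' * v e').
  apply: (@fin_all_exists _ (fun=> 'I_r -> {mpoly K[n]}) (fun e s =>
    (forall e', restr (~: B) (s e') = s e') /\ J (q * v e - \sum_e' s e' * v e'))) => e.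
  by have [s sB Js] := H (q * v e); exists s.
have [s1 _ Js1] := H 1.
pose A := h%:M - 'X_b *: \matrix_(e, e') S e e'.
have JA : J (\det A).
  apply: (fingen_det JI Js1) => e.
  have -> : \sum_e' A e e' * v e' =
      (h - 'X_b * q) * v e + 'X_b * (q * v e - \sum_e' S e e' * v e').
    under eq_bigr => e' _ do rewrite !mxE mulrBl -mulrA.
    rewrite sumrB -mulr_sumr (bigD1 e) //= eqxx mulr1n big1 ?addr0 => [|e' e'e]; first by ring.
    by rewrite eq_sym (negbTE e'e) mulr0n mul0r.
  by apply: is_idealD => //; [apply: is_idealMr | apply: is_idealMl => //; case: (HS e)].
have Xb : restr (K := K) (~: B) 'X_b = 'X_b by rewrite restrXU inE bB.
have A0 : \det A = 0.
  apply: indJ => //; rewrite -det_map_mx; congr (\det _); apply/matrixP => e e'.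
  rewrite !mxE /= rmorphB /= rmorphM /= rmorphMn /= Xb (HS e).1 (restr_sub _ hB) //.
  by rewrite setCS subD1set.
have /eqP : h ^+ r = 0.
  have := congr1 (restr [set b]) A0; rewrite linear0 -det_map_mx => <-.
  rewrite -det_scalar; congr (\det _); apply/matrixP => e e'.
  rewrite !mxE /= rmorphB /= rmorphM /= rmorphMn /= restrXU inE eqxx mul0r subr0.
  rewrite (restr_sub _ hB) //.
  by apply/subsetP => i /set1P ->; rewrite !inE eqxx.
by rewrite expf_eq0 => /andP[_ /eqP].
Qed.

(** By Zorn's lemma there is an ideal maximal among those containing J and disjoint from S; such an
    ideal is prime. *)
Lemma prime_avoiding J (S : polyset K n) : is_ideal J ->
  S 1 -> (forall f g, S f -> S g -> S (f * g)) -> (forall f, J f -> ~ S f) ->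
  exists P, [/\ is_prime P, forall f, J f -> P f & forall f, P f -> ~ S f].
Proof.
move=> JI S1 SM JS.
(* Uniting each set with J accommodates the empty chain, whose union then represents J itself. *)
pose U (X : polyset K n) : polyset K n := fun f => X f \/ J f.
pose Q (X : classical_sets.set {mpoly K[n]}) := is_ideal (U X) /\ forall f, U X f -> ~ S f.
have [F FQ Ftot|A [[AI AS] Amax]] := @classical_sets.Zorn_bigcup _ Q.
  pose UF := U (classical_sets.bigcup F (fun X => X)).
  have UFP f : UF f -> J f \/ exists2 X, F X & X f by case=> [[X FX Xf]|]; [right; exists X|left].
  have UFX X f : F X -> U X f -> UF f by move=> FX [Xf|]; [left; exists X|right].
  split=> [|f]; last first.
    by case/UFP => [/JS //|[X FX Xf]]; apply: (FQ X FX).2; left.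
  split; first by right; apply: is_ideal0.
    move=> f g /UFP [Jf|[X FX Xf]] /UFP [Jg|[Y FY Yg]].
    - by right; apply: is_idealD.
    - by apply: (UFX Y) => //; apply: is_idealD (FQ Y FY).1 _ _ _ _; [right|left].
    - by apply: (UFX X) => //; apply: is_idealD (FQ X FX).1 _ _ _ _; [left|right].
    case: (Ftot X Y FX FY) => [XY|YX].
      by apply: (UFX Y) => //; apply: is_idealD (FQ Y FY).1 _ _ _ _; left => //; apply: XY.
    by apply: (UFX X) => //; apply: is_idealD (FQ X FX).1 _ _ _ _; left => //; apply: YX.
  move=> f g /UFP [Jf|[X FX Xf]]; first by right; apply: is_idealMl.
  by apply: (UFX X) => //; apply: is_idealMl (FQ X FX).1 _ _ _; left.
(* By maximality, the ideal generated by A, J and an f outside them meets S. *)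
have meets f : ~ U A f -> exists a p, U A p /\ S (p + a * f).
  move=> nf; pose X : polyset K n := fun q => exists a p, U A p /\ q = p + a * f.
  have AX q : U A q -> X q by exists 0, q; rewrite mul0r addr0.
  have XX q : U X q -> X q by case=> // Jq; apply: AX; right.
  have : ~ Q X.
    apply: Amax; split=> [q Aq|XA]; first by apply: AX; left.
    apply: nf; left; apply: XA; exists 1, 0; rewrite mul1r add0r; split=> //.
    exact: is_ideal0.
  move=> nQX; apply: boolp.contrapT => nS; apply: nQX; split=> [|q /XX [a [p [Ap ->]]] Sq].
    split; first by right; apply: is_ideal0.
      move=> _ _ /XX [a [p [Ap ->]]] /XX [a' [p' [Ap' ->]]]; left.
      by exists (a + a'), (p + p'); split; [apply: is_idealD|rewrite mulrDl addrACA].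
    move=> _ g /XX [a [p [Ap ->]]]; left; exists (g * a), (g * p).
    by split; [apply: is_idealMl|rewrite mulrDr mulrA].
  by apply: nS; exists a, p.
exists (U A); split=> //; last by right.
split=> // [/AS|f g Afg]; first by apply.
have [|nf] := boolp.EM (U A f); first by left.
have [|ng] := boolp.EM (U A g); first by right.
have [a [p [Ap Sp]]] := meets f nf; have [a' [p' [Ap' Sp']]] := meets g ng.
case: (AS ((p + a * f) * (p' + a' * g))); last exact: SM.
have -> : (p + a * f) * (p' + a' * g) = p * (p' + a' * g) + (a * f * p' + a * a' * (f * g)) by ring.
apply: is_idealD => //; first exact: is_idealMr.
by apply: is_idealD => //; apply: is_idealMl.
Qed.

(** The multiplicative set to avoid consists of the nonzero elements of K[x_B]. *)
Lemma indep_prime J B : is_ideal J -> indep_mod J B ->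
  exists P, [/\ is_prime P, forall f, J f -> P f & indep_mod P B].
Proof.
move=> JI indJ; pose S : polyset K n := fun f => restr (~: B) f = f /\ f != 0.
have [|||P [prP JP PS]] := @prime_avoiding J S JI.
- by split; rewrite ?rmorph1 ?oner_neq0.
- move=> f g [fB f0] [gB g0]; split; last exact: mulf_neq0.
  by rewrite rmorphM /= fB gB.
- by move=> f Jf [fB /eqP]; apply; apply: indJ.
exists P; split=> // f Pf fB; apply/eqP/negPn/negP => f0.
by apply: (PS f).
Qed.

(** Start with a prime P over J that meets K[x_B] in 0 and continue above P + (x_b), over which the
    remaining variables stay independent. Since x_b is not in P, the inclusion is strict. *)
Lemma indep_prime_chain k J B : #|B| = k -> is_ideal J -> fingen J B ->
  indep_mod J B -> prime_chain J k.
Proof.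
elim: k J B => [|k IH] J B cB JI finJ indJ; have [P [prP JP indP]] := indep_prime JI indJ.
  by exists (fun=> P).
have [b bB] : exists b, b \in B by apply/card_gt0P; rewrite cB.
have PI : is_ideal P by case: prP.
have finP := fingen_sub JP finJ.
have [|Q [prQ ltQ]] := IH (add_var P b) (B :\ b) _ (add_var_ideal b PI)
    (fingen_add_var PI bB finP) (indep_mod_add_var PI bB finP indP).
  by move: cB; rewrite (cardsD1 b) bB => -[].
have Q0 := (prQ 0%N isT).2.
exists (fun j => if j is j'.+1 then Q j' else P); split.
  case=> [|j] jk; first by split.
  by split=> [|f Jf]; [case: (prQ j jk)|apply/(prQ j jk).2/sub_add_var/JP].
case=> [|j] jk; last exact: ltQ.
split=> [f Pf|]; first exact/Q0/sub_add_var.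
exists 'X_b; split; first by apply: Q0; exists 1; rewrite mulr1 subrr; apply: is_ideal0.
move=> /indP; rewrite restrXU inE bB => /(_ erefl) /(congr1 (mcoeff U_(b))) /eqP.
by rewrite mcoeffX eqxx mcoeff0 oner_eq0.
Qed.

Lemma prime_chain_leq J k k' : (k' <= k)%N -> prime_chain J k -> prime_chain J k'.
Proof.
move=> kk' [P [prP ltP]]; exists P.
by split=> j jk; [apply: prP|apply: ltP]; apply: leq_trans jk kk'.
Qed.

Lemma prime_chain_sub J J' k : (forall f, J f -> J' f) -> prime_chain J' k -> prime_chain J k.
Proof.
move=> JJ' [P [prP ltP]]; exists P; split=> // j jk.
by split=> [|f Jf]; [case: (prP j jk)|apply/(prP j jk).2/JJ'].
Qed.

(** A chain is pulled back along the automorphism; the converse applies this to the inverse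
    matrix. *)
Lemma prime_chain_gact J (g : 'M[K]_n) k : g \in unitmx ->
  prime_chain (gact_set g J) k <-> prime_chain J k.
Proof.
have impl (g' : 'M[K]_n) J' : g' \in unitmx -> prime_chain (gact_set g' J') k -> prime_chain J' k.
  move=> gU [P [prP ltP]]; exists (fun j f => P j (gact g' f)); split=> j jk.
    have [[[P0 PD PM] P1 Ppr] JP] := prP j jk.
    split=> [|f Jf]; last by apply: JP; exists f.
    split=> [|P1'|f h]; last by rewrite rmorphM; apply: Ppr.
    - split; rewrite ?linear0 // => f h; first by rewrite linearD; apply: PD.
      by rewrite rmorphM; apply: PM.
    by apply: P1; rewrite -(rmorph1 (gact g')).
  have [PP [f [Pf nPf]]] := ltP j jk; split=> [h|]; first exact: PP.
  by exists (gact (invmx g') f); rewrite gactVK.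
move=> gU; split; first exact: impl.
move=> chJ; apply: (impl (invmx g)); first by rewrite unitmx_inv.
apply: prime_chain_sub chJ => f; rewrite -gact_set_gact_set mulmxV //.
by case=> h [Jh ->]; rewrite gact1.
Qed.

Lemma prime_chain_proper J k : prime_chain J k -> ~ J 1.
Proof. by case=> P [prP _] J1; have [[_ P1 _] JP] := prP 0%N isT; apply/P1/JP. Qed.

End Chains.

(** A nonzero relation in K[x_B] would yield finiteness over m - 1 variables after another change of
    coordinates, contradicting the counting bound. *)
Lemma finite_over_indep (K : closedFieldType) (n m : nat) (J : polyset K n) (B : {set 'I_n}) :
  is_graded J -> prime_chain J m -> #|B| = m -> finite_over J B -> indep_mod J B.
Proof.
move=> JG chJ cB finJ F JF FB; apply/eqP/negPn/negP => F0.
have [b bB [g gU fing]] := finite_over_step JG (prime_chain_proper chJ) finJ JF FB F0.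
have := prime_chain_le (gact_set_graded JG gU) fing ((prime_chain_gact J m gU).2 chJ).
by rewrite -cB (cardsD1 b B) bB ltnn.
Qed.

(** Variables are eliminated one at a time: while more than m remain they satisfy a relation, since
    independence would produce a prime chain of length m + 1. *)
Lemma noether_normalization (K : closedFieldType) (n m : nat) (J : polyset K n) :
  is_graded J -> quot_dim J m -> (m <= n)%N ->
  exists2 g : 'M[K]_n, g \in unitmx &
  exists2 B : {set 'I_n}, #|B| = m & finite_over (gact_set g J) B.
Proof.
move=> JG [chJ nchJ] mn; have [JI _] := JG.
suff main t : (t <= n - m)%N -> exists2 g : 'M[K]_n, g \in unitmx &
    exists2 B : {set 'I_n}, #|B| = (n - t)%N & finite_over (gact_set g J) B.
  by have [g gU [B cB finB]] := main _ (leqnn _); exists g => //; exists B; rewrite ?cB ?subKn.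
elim: t => [|t IH] tm.
  exists 1%:M; first exact: unitmx1.
  exists setT; first by rewrite cardsT card_ord subn0.
  exists 1%N => i; exists 0; first by apply: is_ideal0; apply: gact_set_ideal; [case: JG|exact: unitmx1].
  by rewrite linear0 expr1 restrXU inE.
have [g gU [B cB fing]] := IH (ltnW tm).
have chg := (prime_chain_gact J m gU).2 chJ; have gG := gact_set_graded JG gU.
have [F [JF FB F0]] : exists F, [/\ gact_set g J F, restr (~: B) F = F & F != 0].
  apply: boolp.contrapT => nF; apply: nchJ; apply/(prime_chain_gact _ _ gU).
  have : (m.+1 <= n - t)%N by lia.
  move/prime_chain_leq; apply; apply: indep_prime_chain cB (gact_set_ideal JI gU) _ _.
    exact: finite_over_fingen.
  by move=> F JF FB; apply/eqP/negPn/negP => F0; apply: nF; exists F.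
have [b bB [h hU finh]] := finite_over_step gG (prime_chain_proper chg) fing JF FB F0.
exists (g *m h); first by rewrite unitmx_mul gU.
exists (B :\ b); first by move: cB; rewrite (cardsD1 b B) bB; lia.
by apply: finite_over_sub finh => f; rewrite gact_set_gact_set.
Qed.

(** * Generic finiteness *)

Section PolynomialFunctions.
Variables (K : fieldType) (n : nat).
Implicit Types (F G : 'M[K]_n -> K) (f : {mpoly K[n]}).

Definition polyfun F := exists p : {mpoly K[n * n]}, forall g, F g = p.@[fun i => mxvec g 0 i].

Lemma eq_polyfun F G : F =1 G -> polyfun F -> polyfun G.
Proof. by move=> FG [p pE]; exists p => g; rewrite -FG. Qed.

Lemma polyfun_const c : polyfun (fun=> c).
Proof. by exists c%:MP => g; rewrite mevalC. Qed.

Lemma polyfun_coord i j : polyfun (fun g => g i j).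
Proof. by exists 'X_(mxvec_index i j) => g; rewrite mevalXU mxvecE. Qed.

Lemma polyfunD F G : polyfun F -> polyfun G -> polyfun (fun g => F g + G g).
Proof. by move=> [p pE] [q qE]; exists (p + q) => g; rewrite mevalD pE qE. Qed.

Lemma polyfunM F G : polyfun F -> polyfun G -> polyfun (fun g => F g * G g).
Proof. by move=> [p pE] [q qE]; exists (p * q) => g; rewrite mevalM pE qE. Qed.

Lemma polyfun_sum (I : Type) (r : seq I) (P : pred I) (H : I -> 'M[K]_n -> K) :
  (forall i, polyfun (H i)) -> polyfun (fun g => \sum_(i <- r | P i) H i g).
Proof.
move=> pH; elim: r => [|i r IH].
  by apply: eq_polyfun (polyfun_const 0) => g; rewrite big_nil.
case Pi : (P i); last by apply: eq_polyfun IH => g; rewrite big_cons Pi.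
by apply: eq_polyfun (polyfunD (pH i) IH) => g; rewrite big_cons Pi.
Qed.

Lemma polyfun_prod (I : Type) (r : seq I) (P : pred I) (H : I -> 'M[K]_n -> K) :
  (forall i, polyfun (H i)) -> polyfun (fun g => \prod_(i <- r | P i) H i g).
Proof.
move=> pH; elim: r => [|i r IH].
  by apply: eq_polyfun (polyfun_const 1) => g; rewrite big_nil.
case Pi : (P i); last by apply: eq_polyfun IH => g; rewrite big_cons Pi.
by apply: eq_polyfun (polyfunM (pH i) IH) => g; rewrite big_cons Pi.
Qed.

Lemma polyfun_det r (A : 'M[K]_n -> 'M[K]_r) :
  (forall i j, polyfun (fun g => A g i j)) -> polyfun (fun g => \det (A g)).
Proof.
move=> pA; rewrite /determinant; apply: polyfun_sum => s.
by apply: polyfunM; [exact: polyfun_const | apply: polyfun_prod => i].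
Qed.

Let polyfam (H : 'M[K]_n -> {mpoly K[n]}) := forall m, polyfun (fun g => (H g)@_m).

Let polyfamM H H' : polyfam H -> polyfam H' -> polyfam (fun g => H g * H' g).
Proof.
move=> pH pH' m; apply: eq_polyfun => [g|]; first by rewrite mcoeffM.
by apply: polyfun_sum => k; apply: polyfunM.
Qed.

Let polyfam1 : polyfam (fun=> 1).
Proof. by move=> m; apply: polyfun_const. Qed.

Lemma polyfun_mcoeff_gact f m : polyfun (fun g => (gact g f)@_m).
Proof.
pose H (i : 'I_n) (g : 'M[K]_n) : {mpoly K[n]} := \sum_(j < n) g i j *: 'X_j.
have pH i : polyfam (H i).
  move=> k; apply: eq_polyfun (polyfun_sum (index_enum 'I_n) predT
    (fun j => polyfunM (polyfun_coord i j) (polyfun_const ('X_j)@_k))) => g.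
  by rewrite raddf_sum /=; apply: eq_bigr => j _; rewrite mcoeffZ.
have pHX i d : polyfam (fun g => H i g ^+ d).
  elim: d => [|d IH] k; first exact: polyfam1.
  by apply: eq_polyfun (polyfamM (pH i) IH k) => g; rewrite exprS.
have pP (r : seq 'I_n) (k : 'X_{1..n}) : polyfam (fun g => \prod_(i <- r) H i g ^+ k i).
  elim: r => [|i r IH] l; first by apply: eq_polyfun (polyfam1 l) => g; rewrite big_nil.
  by apply: eq_polyfun (polyfamM (pHX i (k i)) IH l) => g; rewrite big_cons.
apply: eq_polyfun (polyfun_sum (msupp f) predT
  (fun k => polyfunM (polyfun_const f@_k) (pP _ k m))) => g.
rewrite /gact -/(subst _ _) substE raddf_sum /=.
by apply: eq_bigr => k _; rewrite mcoeffZ.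
Qed.

End PolynomialFunctions.

(** * Transport and openness of finiteness *)

Section GenericFiniteness.
Variables (K : fieldType) (n : nat).
Implicit Types (J : polyset K n) (B C : {set 'I_n}).

(** List B followed by its complement, do the same for C, and match positions. *)
Lemma exists_perm_set B C : #|B| = #|C| -> exists s : 'S_n, forall i, (s i \in C) = (i \in B).
Proof.
move=> cBC; pose e (D : {set 'I_n}) := enum D ++ enum (~: D).
have size_e D : size (e D) = n by rewrite size_cat -!cardE cardsC card_ord.
have uniq_e D : uniq (e D).
  rewrite cat_uniq !enum_uniq andbT; apply/hasPn => i.
  by rewrite !mem_enum inE.
have mem_e D i : i \in e D by rewrite mem_cat !mem_enum inE orbN.
have lt_e D i : (index i (e D) < n)%N by have := mem_e D i; rewrite -index_mem size_e.
have lt_e_in D i : (index i (e D) < #|D|)%N = (i \in D).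
  rewrite index_cat mem_enum; case: ifP => iD; first by rewrite cardE index_mem mem_enum.
  by rewrite -cardE ltnNge leq_addr.
pose f i := nth i (e C) (index i (e B)).
have index_f i : index (f i) (e C) = index i (e B) by rewrite index_uniq ?size_e.
have f_inj : injective f.
  move=> i j fij; have := index_f i; rewrite fij index_f.
  by move=> /(congr1 (nth i (e B))); rewrite !nth_index.
by exists (perm f_inj) => i; rewrite permE -!lt_e_in index_f cBC.
Qed.

(** The permutation matrix carries (x_B) to (x_C) and permutes the powers of the variables. *)
Lemma finite_over_perm J B C : #|B| = #|C| -> finite_over J B ->
  exists2 g : 'M[K]_n, g \in unitmx & finite_over (gact_set g J) C.
Proof.
move=> /exists_perm_set [s sP] [N HN]; exists (perm_mx s); first exact: unitmx_perm.
have gX i : gact (perm_mx s : 'M[K]_n) 'X_i = 'X_(s i).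
  rewrite gactXU (bigD1 (s i)) //= big1 => [|j ji]; rewrite !mxE.
    by rewrite eqxx scale1r addr0.
  by rewrite eq_sym (negbTE ji) scale0r.
have comm (f : {mpoly K[n]}) : restr C (gact (perm_mx s) f) = gact (perm_mx s) (restr B f).
  rewrite /restr /gact -!/(subst _ _) !subst_subst; apply: eq_subst => i.
  transitivity (restr C (gact (perm_mx s : 'M[K]_n) 'X_i)); first by rewrite gactXU.
  rewrite gX restrXU sP; case: ifP => _; first by rewrite linear0.
  by rewrite substXU -gactXU gX.
exists N => i; have [phi Jphi phiE] := HN ((s^-1)%g i).
exists (gact (perm_mx s) phi); first by exists phi.
by rewrite comm phiE -comm rmorphXn /= gX permKV.
Qed.

(** For each monomial t of a large degree D outside x_B choose psi_t in J whose image under g0 is t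
    modulo (x_B). The coefficient matrix M(g) of the images of the psi_t modulo (x_B) is the
    identity at g0, and wherever its determinant is nonzero all the t are recovered. *)
Lemma finite_over_open J B (g0 : 'M[K]_n) : is_graded J -> g0 \in unitmx ->
  finite_over (gact_set g0 J) B ->
  exists p : {mpoly K[n * n]}, p != 0 /\
    forall g, p.@[fun i => mxvec g 0 i] != 0 -> finite_over (gact_set g J) B.
Proof.
move=> JG g0U fin0; have [JI _] := JG; have [J0I J0G] := gact_set_graded JG g0U.
have [N HN] := finite_over_gt0 J0I fin0.
(* In degree D every monomial is divisible by some x_i^(N+1). *)
pose D := (n * N).+1.
have Hmon m : mdeg m = D -> exists psi, [/\ J psi, psi \is D.-homog &
    restr B (gact g0 psi) = restr B 'X_[m]].
  move=> mD; have [i mi] : exists i, (N < m i)%N.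
    apply/existsP; apply: contra_eqT mD; rewrite negb_exists => /forallP mN.
    rewrite neq_ltn ltnS mdegE -[X in (X * N)%N]card_ord -sum_nat_const.
    by rewrite leq_sum // => i _; rewrite leqNgt.
  have [phi [psi [Jpsi ->]] phiE] := HN i.
  pose m' := (m - U_(i) *+ N.+1)%MM.
  have mE : m = (m' + U_(i) *+ N.+1)%MM.
    rewrite submK //; apply/mnm_lepP => j; rewrite mulmnE mnm1E.
    by case: eqP => [<-|_]; rewrite ?mul1n ?mul0n.
  exists (pihomog mdeg D (gact (invmx g0) 'X_[m'] * psi)); split.
  - by apply: JG.2; apply: is_idealMl.
  - exact: pihomogP.
  rewrite -pihomog_gact rmorphM /= gactVK // -pihomog_restr rmorphM /= phiE -rmorphM /=.
  rewrite mpolyXn -mpolyXD -mE pihomog_restr pihomog_dE // dhomogX.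
  exact/eqP.
(* These monomials form a basis of the forms of degree D modulo (x_B). *)
pose T : finType := {m : 'X_{1..n < D.+1} | (mdeg m == D) && [forall i in B, m i == 0%N]}.
have TD (t : T) : mdeg (val (val t)) = D by case/andP: (valP t) => /eqP.
have TB (t : T) i : i \in B -> (val (val t)) i = 0%N.
  by case/andP: (valP t) => _ /forall_inP H /H /eqP.
have /fin_all_exists [psi Hpsi] (t : T) := Hmon _ (TD t).
pose M g := \matrix_(i < #|T|, j < #|T|)
  (restr B (gact g (psi (enum_val i))))@_(val (val (enum_val j))).
have [p pE] : polyfun (fun g => \det (M g)).
  apply: polyfun_det => i j; apply: eq_polyfun (polyfun_mcoeff_gact (psi (enum_val i))
    (val (val (enum_val j)))) => g.
  rewrite mxE mcoeff_restr; case: ifP => // /negbT /forall_inPn [k kB].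
  by rewrite (TB _ k kB).
exists p; split.
  have : p.@[fun i => mxvec g0 0 i] != 0.
    rewrite -pE; suff -> : M g0 = 1%:M by rewrite det1 oner_neq0.
    apply/matrixP => i j; rewrite !mxE; have [_ _ ->] := Hpsi (enum_val i).
    rewrite restr_id => [|m /mem_msuppXP <- k kB]; last exact: TB.
    by rewrite mcoeffX !val_eqE (inj_eq enum_val_inj).
  by apply: contraNneq => ->; rewrite meval0.
move=> g; rewrite -pE => detM.
have MU : M g \in unitmx by rewrite unitmxE unitfE.
exists D => i; have [iB|iB] := boolP (i \in B).
  exists 0; last by rewrite linear0 rmorphXn /= restrXU iB expr0n.
  by exists 0; rewrite linear0; split=> //; apply: is_ideal0.
have tP : (mdeg (U_(i) *+ D)%MM < D.+1)%N by rewrite mdegMn mdeg1 mul1n.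
have tP' : (mdeg (BMultinom tP) == D) && [forall k in B, (BMultinom tP) k == 0%N].
  rewrite /= mdegMn mdeg1 mul1n eqxx; apply/forall_inP => k kB.
  by rewrite mulmnE mnm1E; case: (i =P k) iB => [->|_ _]; rewrite ?kB ?mul0n.
pose t : T := Sub (BMultinom tP) tP'.
(* The row of the inverse matrix belonging to x_i^D. *)
pose c k := invmx (M g) (enum_rank t) k.
exists (gact g (\sum_k c k *: psi (enum_val k))).
  exists (\sum_k c k *: psi (enum_val k)); split=> //.
  by apply: is_ideal_sum => // k _; apply: is_idealZ => //; case: (Hpsi (enum_val k)).
have restrE k : restr B (gact g (psi (enum_val k))) =
    \sum_j M g k j *: 'X_[val (val (enum_val j))].
  apply/mpolyP => m; rewrite [RHS]raddf_sum /=.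
  under [RHS] eq_bigr => j _ do rewrite mcoeffZ mcoeffX mxE.
  have homk : restr B (gact g (psi (enum_val k))) \is D.-homog.
    by apply/dhomog_restr/dhomog_gact; case: (Hpsi (enum_val k)).
  have [mP|mP] := boolP ((mdeg m == D) && [forall k in B, m k == 0%N]).
    have mlt : (mdeg m < D.+1)%N by case/andP: mP => /eqP ->.
    pose u : T := Sub (BMultinom mlt) mP.
    rewrite (bigD1 (enum_rank u)) //= enum_rankK /= eqxx mulr1 big1 ?addr0 // => j ju.
    case: eqP => [e|_]; last by rewrite mulr0.
    case/eqP: ju; apply: enum_val_inj; rewrite enum_rankK; do 2!apply: val_inj.
    exact: e.
  rewrite big1 => [|j _].
    apply/eqP; rewrite mcoeff_eq0; apply: contra mP => mk.
    rewrite (dhomog_mf homk mk) eqxx /=; move: mk; rewrite mcoeff_msupp mcoeff_restr.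
    by case: ifP => //; rewrite eqxx.
  case: eqP => [e|_]; last by rewrite mulr0.
  by case/negP: mP; rewrite -e; case/andP: (valP (enum_val j)) => -> ->.
rewrite (linear_sum (gact g)) (linear_sum (restr B)) /=; under eq_bigr => k _ do
  rewrite !linearZ /= restrE scaler_sumr.
rewrite exchange_big /=.
transitivity (\sum_j (invmx (M g) *m M g) (enum_rank t) j *: 'X_[val (val (enum_val j))] : {mpoly K[n]}).
  apply: eq_bigr => j _; rewrite mxE scaler_suml.
  by apply: eq_bigr => k _; rewrite scalerA.
rewrite mulVmx // (bigD1 (enum_rank t)) //= big1 => [|j jt]; rewrite !mxE.
  rewrite eqxx scale1r addr0 enum_rankK /= mpolyXn restr_id // => m /mem_msuppXP <- k kB.
  by rewrite mulmnE mnm1E; case: (i =P k) iB => [->|_ _]; rewrite ?kB ?mul0n.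
by rewrite eq_sym (negbTE jt) scale0r.
Qed.

End GenericFiniteness.

Theorem generic_finite_over (K : closedFieldType) (n m : nat) (J : polyset K n) :
  is_graded J -> quot_dim J m -> (m <= n)%N ->
  exists U : 'M[K]_n -> Prop, [/\ zariski_open_GL U, exists g, U g &
    forall g, U g -> g \in unitmx /\ forall B : {set 'I_n}, #|B| = m -> finite_over (gact_set g J) B].
Proof.
move=> JG dimJ mn; have [g0 g0U [B0 cB0 fin0]] := noether_normalization JG dimJ mn.
have /fin_all_exists [p Hp] (B : {set 'I_n}) : exists p : {mpoly K[n * n]}, p != 0 /\
    (#|B| = m -> forall g, p.@[fun i => mxvec g 0 i] != 0 -> finite_over (gact_set g J) B).
  (* Sets of another size impose no condition, so p = 1 serves for them. *)
  have [cB|cB] := eqVneq #|B| m; last by exists 1; rewrite oner_neq0; split=> // /eqP; rewrite (negbTE cB).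
  have [|h hU finh] := @finite_over_perm _ _ _ B0 B _ fin0; first by rewrite cB0.
  have [||p [p0 pP]] := @finite_over_open _ _ J B (g0 *m h) JG; last by exists p.
  - by rewrite unitmx_mul g0U.
  - by apply: finite_over_sub finh => f; rewrite gact_set_gact_set.
have [q qE] : polyfun (fun g : 'M[K]_n => \det g) by apply: polyfun_det => i j; apply: polyfun_coord.
have q0 : q != 0.
  have : q.@[fun i => mxvec (1%:M : 'M[K]_n) 0 i] != 0 by rewrite -qE det1 oner_neq0.
  by apply: contraNneq => ->; rewrite meval0.
(* The determinant factor [q] ensures that a point where P does not vanish is an invertible
   matrix. *)
pose P := q * \prod_B p B.
have P0 : P != 0 by rewrite mulf_neq0 //; apply/prodf_neq0 => B _; case: (Hp B).
exists (fun g => g \in unitmx /\ exists p', p' = P /\ p'.@[fun i => mxvec g 0 i] != 0); split.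
- by exists (fun p' => p' = P).
- have [v Pv] := mpoly_nonroot P0; pose g := vec_mx (\row_i v i).
  have vE : P.@[fun i => mxvec g 0 i] = P.@[v] by apply: meval_eq => i; rewrite vec_mxK mxE.
  exists g; split; last by exists P; rewrite vE.
  rewrite unitmxE unitfE qE; apply: contraNneq Pv => qg.
  by rewrite -vE mevalM qg mul0r.
move=> g [gU [_ [-> Pg]]]; split=> // B cB; apply: (Hp B).2 => //.
by apply: contraNneq Pg => pg; rewrite mevalM rmorph_prod (bigD1 B) //= pg mul0r mulr0.
Qed.

(** * Tropical varieties *)

Section InitialForms.
Variables (R : realType) (K : fieldType) (n : nat).
Implicit Types (w : 'rV[R]_n) (f : {mpoly K[n]}) (k : 'X_{1..n}).

Lemma wdotD w k1 k2 : wdot w (k1 + k2)%MM = wdot w k1 + wdot w k2.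
Proof.
by rewrite /wdot -big_split; apply: eq_bigr => i _; rewrite mnmDE natrD mulrDr.
Qed.

Lemma wdotU w i : wdot w U_(i)%MM = w 0 i.
Proof.
rewrite /wdot (bigD1 i) //= mnm1E eqxx mulr1 big1 ?addr0 // => j ji.
by rewrite mnm1E eq_sym (negbTE ji) mulr0.
Qed.

Lemma wdotMn w k d : wdot w (k *+ d)%MM = wdot w k * d%:R.
Proof. by rewrite /wdot mulr_suml; apply: eq_bigr => i _; rewrite mulmnE natrM mulrA. Qed.

Lemma wdot_ge0 w k : (forall i, 0 <= w 0 i) -> 0 <= wdot w k.
Proof. by move=> w0; apply: sumr_ge0 => i _; rewrite mulr_ge0. Qed.

Lemma wdot_gt0 w k i : (forall i, 0 <= w 0 i) -> 0 < w 0 i -> k i != 0%N -> 0 < wdot w k.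
Proof.
move=> w0 wi ki; rewrite /wdot (bigD1 i) //= ltr_wpDr //.
  by apply: sumr_ge0 => j _; rewrite mulr_ge0.
by rewrite mulr_gt0 // ltr0n lt0n.
Qed.

Lemma mcoeff_initf w f k :
  (initf w f)@_k = if all (fun k' => wdot w k <= wdot w k') (msupp f) then f@_k else 0.
Proof.
rewrite /initf raddf_sum /= big_mkcond /=.
transitivity (\sum_(l <- msupp f)
    (if all (fun k' => wdot w k <= wdot w k') (msupp f) then f@_l * (l == k)%:R else 0)).
  apply: eq_bigr => l _; rewrite mcoeffZ mcoeffX.
  by have [->|_] := eqVneq l k; last by rewrite mulr0 !if_same.
case: ifP => _; last by rewrite big1.
rewrite [f in RHS]mpolyE raddf_sum /=.
by apply: eq_bigr => l _; rewrite mcoeffZ mcoeffX.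
Qed.

Lemma initf_monomialP w f : is_monomial (initf w f) <->
  exists2 k0, k0 \in msupp f & forall k, k \in msupp f -> k != k0 -> wdot w k0 < wdot w k.
Proof.
split=> [[c [k0 [c0 fE]]]|[k0 k0f k0min]].
  have := congr1 (mcoeff k0) fE; rewrite mcoeff_initf mcoeffZ mcoeffX eqxx mulr1.
  case: ifP => [/allP k0min fk0|_ /esym/eqP]; last by rewrite (negbTE c0).
  exists k0 => [|k kf kk0]; first by rewrite mcoeff_msupp fk0.
  have := congr1 (mcoeff k) fE; rewrite mcoeff_initf mcoeffZ mcoeffX eq_sym (negbTE kk0) mulr0.
  case: ifP => [_ /eqP|/negbT]; first by rewrite mcoeff_eq0 kf.
  by case/allPn => l lf; rewrite -ltNge => lk _; apply: le_lt_trans lk; apply: k0min.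
exists f@_k0, k0; split; first by rewrite -mcoeff_msupp.
apply/mpolyP => k; rewrite mcoeff_initf mcoeffZ mcoeffX eq_sym.
have [->|kk0] := eqVneq k k0.
  rewrite mulr1; case: ifP => // /negbT/allPn [l lf]; rewrite -ltNge => lk0.
  have lk : l != k0 by apply: contraTneq lk0 => ->; rewrite ltxx.
  by have := lt_trans lk0 (k0min l lf lk); rewrite ltxx.
rewrite mulr0; case: ifP => // /allP kmin; apply: memN_msupp_eq0; apply/negP => kf.
by have := le_lt_trans (kmin k0 k0f) (k0min k kf kk0); rewrite ltxx.
Qed.

End InitialForms.

Lemma exists_subset_card (T : finType) (A C : {set T}) k :
  A \subset C -> (#|A| <= k <= #|C|)%N ->
  exists B : {set T}, [/\ A \subset B, B \subset C & #|B| = k].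
Proof.
move=> AC /andP[Ak kC]; pose s := take (k - #|A|) (enum (C :\: A)).
have sP x : x \in s -> (x \in C) && (x \notin A).
  by move=> /mem_take; rewrite mem_enum inE andbC.
exists (A :|: [set x in s]); split; first exact: subsetUl.
  apply/subsetP => x; rewrite !inE => /orP[/(subsetP AC) //|/sP /andP[] //].
rewrite cardsU disjoint_setI0 ?cards0 ?subn0; last first.
  rewrite disjoint_subset; apply/subsetP => x xA; rewrite !inE.
  by apply/negP => /sP; rewrite xA andbF.
have -> : #|[set x in s]| = size s.
  by rewrite cardsE; apply/card_uniqP; rewrite take_uniq // enum_uniq.
rewrite size_takel ?subnKC // -cardE cardsD leq_sub //.
by rewrite (setIidPr AC).
Qed.

(** * The two inclusions between the tropical variety and the skeleton *)

Section TropicalInclusions.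
Variables (R : realType) (K : fieldType) (n m : nat) (J : polyset K n).
Implicit Types (w : 'rV[R]_n) (B T : {set 'I_n}).

Lemma trop_sub_skeleton w : (m < n)%N -> is_graded J ->
  (forall B, #|B| = m -> finite_over J B) -> trop J w -> skeleton m w.
Proof.
move=> mn [JI JG] finJ tropw.
pose A := [set i | [forall k, w 0 i <= w 0 k]].
have [i iA] : exists i, i \in A.
  have i0 : 'I_n := Ordinal (leq_ltn_trans (leq0n m) mn).
  case: (@Order.TotalTheory.arg_minP _ _ _ i0 predT (fun i => w 0 i)) => // i _ imin.
  by exists i; rewrite inE; apply/forallP => k; apply: imin.
have imin k : w 0 i <= w 0 k by move: iA; rewrite inE => /forallP.
have [Am|Am] := leqP (n - #|A| + 1) m.
  exists A; split; first by apply/set0Pn; exists i.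
  by split=> // j; rewrite inE => /forallP.
(* At most n - m coordinates are minimal here, so m of the others can be chosen. *)
have [|B [_ BA cB]] := @exists_subset_card _ set0 (~: A) m (sub0set _).
  by rewrite cards0 cardsCs setCK card_ord; lia.
have iB : i \notin B by apply/negP => /(subsetP BA); rewrite inE iA.
have wB j : j \in B -> w 0 i < w 0 j.
  move=> /(subsetP BA); rewrite !inE negb_forall => /existsP [k]; rewrite -ltNge.
  exact: le_lt_trans.
have [N HN] := finJ B cB; have [phi0 Jphi0 phi0E] := HN i.
pose phi := pihomog mdeg N phi0.
have phiE : restr B phi = 'X_[U_(i) *+ N].
  rewrite -pihomog_restr phi0E rmorphXn /= restrXU (negbTE iB) mpolyXn pihomog_dE // dhomogX.
  by rewrite /= mdegMn mdeg1 mul1n.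
case: (tropw phi); first exact: JG.
apply/initf_monomialP; exists (U_(i) *+ N)%MM.
  rewrite mcoeff_msupp; have := congr1 (mcoeff (U_(i) *+ N)%MM) phiE.
  rewrite mcoeff_restr mcoeffX eqxx; case: ifP => _; first by move=> ->; rewrite oner_neq0.
  by move/esym/eqP; rewrite oner_eq0.
move=> k kphi ki; have [j jB kj] : exists2 j, j \in B & k j != 0%N.
  apply/exists_inP; apply: contraNT ki; rewrite negb_exists_in => /forall_inP k0.
  have := congr1 (mcoeff k) phiE; rewrite mcoeff_restr mcoeffX ifT.
    by case: eqP => [-> //|_ /eqP]; rewrite mcoeff_eq0 kphi.
  by apply/forall_inP => j /k0; rewrite negbK.
have kdeg : mdeg k = N by apply: (dhomog_mf (pihomogP mdeg N phi0) kphi).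
(* As k has degree N, the difference of weights is the sum of the (w_l - w_i) k_l; all summands are
   nonnegative and that of j is positive. *)
rewrite wdotMn wdotU -kdeg mdegE natr_sum mulr_sumr -subr_gt0 /wdot -sumrB.
rewrite (bigD1 j) //= ltr_wpDr //.
  by apply: sumr_ge0 => l _; rewrite -mulrBl mulr_ge0 // subr_ge0.
by rewrite -mulrBl mulr_gt0 ?subr_gt0 ?wB // ltr0n lt0n.
Qed.

Section Weights.
Variables (w : 'rV[R]_n) (w_ge0 : forall i, 0 <= w 0 i).
Implicit Types (f p q : {mpoly K[n]}) (c : R).

Let ge c f := forall k, k \in msupp f -> c <= wdot w k.
Let gt c f := forall k, k \in msupp f -> c < wdot w k.

Let gt0 c : gt c 0. Proof. by move=> k; rewrite msupp0. Qed.

Let gtD c f p : gt c f -> gt c p -> gt c (f + p).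
Proof. by move=> fc pc k /msuppD_le; rewrite mem_cat => /orP[/fc|/pc]. Qed.

Let gtZ c a f : gt c f -> gt c (a *: f).
Proof. by move=> fc k /msuppZ_le /fc. Qed.

Let geM c d f p : ge c f -> ge d p -> ge (c + d) (f * p).
Proof.
move=> fc pd k /msuppM_le /allpairsP [[k1 k2] /= [/fc h1 /pd h2 ->]].
by rewrite wdotD lerD.
Qed.

Let gt_geM c d f p : gt c f -> ge d p -> gt (c + d) (f * p).
Proof.
move=> fc pd k /msuppM_le /allpairsP [[k1 k2] /= [/fc h1 /pd h2 ->]].
by rewrite wdotD ltr_leD.
Qed.

Let ge0 f : ge 0 f.
Proof. by move=> k _; apply: wdot_ge0. Qed.

Let gtMr c f p : gt c f -> gt c (f * p).
Proof. by move=> fc; have := gt_geM fc (@ge0 p); rewrite addr0. Qed.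

(** Telescoping: replacing one factor a_i by a_i - q_i changes the product only by terms above the
    expected weight. *)
Lemma weight_prod_sub (I : Type) (s : seq I) c (a q : I -> {mpoly K[n]}) :
  (forall i, ge c (a i)) -> (forall i, gt c (q i)) ->
  ge ((size s)%:R * c) (\prod_(i <- s) a i) /\
  gt ((size s)%:R * c) (\prod_(i <- s) (a i - q i) - \prod_(i <- s) a i).
Proof.
move=> ac qc; elim: s => [|i s [IH1 IH2]].
  by rewrite !big_nil mul0r subrr.
rewrite !big_cons /= -natr1 mulrDl mul1r [_ + c]addrC; split; first exact: geM.
have -> : (a i - q i) * \prod_(j <- s) (a j - q j) - a i * \prod_(j <- s) a j =
   (\prod_(j <- s) (a j - q j) - \prod_(j <- s) a j) * (a i - q i)
   + (-1) *: (q i * \prod_(j <- s) a j) by rewrite scaleN1r; ring.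
apply: gtD; last by apply: gtZ; apply: gt_geM.
rewrite addrC; apply: gt_geM => // k /msuppB_le; rewrite mem_cat => /orP[/ac //|/qc /ltW //].
Qed.

(** In the Leibniz expansion, dropping Q changes each product only by heavier terms; a scalar matrix
    remains. *)
Lemma weight_det_sub r c u (Q : 'M[{mpoly K[n]}]_r) :
  ge c u -> (forall i j, gt c (Q i j)) -> gt (r%:R * c) (\det (u%:M - Q) - u ^+ r).
Proof.
move=> uc Qc; rewrite -det_scalar /determinant -sumrB.
apply: (big_ind (gt (r%:R * c))); [exact: gt0|exact: gtD|move=> s _]; rewrite -mulrBr [(-1) ^+ s * _]mulrC; apply: gtMr.
have uM i j : ge c ((u%:M : 'M_r) i j).
  by rewrite mxE; case: (i == j) => //; move=> k; rewrite mulr0n msupp0.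
have [_] := weight_prod_sub (index_enum 'I_r) (fun i => uM i (s i)) (fun i => Qc i (s i)).
have -> : size (index_enum 'I_r) = r by rewrite /index_enum -enumT size_enum_ord.
have -> : \prod_i (u%:M - Q) i (s i) = \prod_i ((u%:M : 'M_r) i (s i) - Q i (s i)) by
  apply: eq_bigr => i _; rewrite !mxE.
exact.
Qed.

Variable B : {set 'I_n}.
Hypotheses (w_B : forall i, i \in B -> 0 < w 0 i) (w_notB : forall i, i \notin B -> w 0 i = 0).

(** The sum of J and the polynomials whose terms all weigh more than c, an ideal because no weight
    is negative. *)
Let bb c f := exists2 G, gt c G & J (f - G).

Let bb_ideal c : is_ideal J -> is_ideal (bb c).
Proof.
move=> JI; split=> [|f p [G Gc JG] [G' Gc' JG']|f p [G Gc JG]].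
- by exists 0; rewrite ?subrr //; apply: is_ideal0.
- by exists (G + G'); [exact: gtD|rewrite opprD addrACA; apply: is_idealD].
by exists (p * G); [rewrite mulrC; exact: gtMr|rewrite -mulrBr; apply: is_idealMl].
Qed.

Let gt_bb c f : is_ideal J -> gt c f -> bb c f.
Proof. by move=> JI fc; exists f => //; rewrite subrr; apply: is_ideal0. Qed.

(** Finiteness serves twice: over B enlarged by an index outside T, to move exponents into T at
    constant weight, and over T itself, for the determinant. Independence over T gives the
    contradiction. *)
Lemma no_weight_monomial f nu : (#|B|.+1 = m)%N -> (m <= n)%N -> is_graded J ->
  (forall T, #|T| = m -> finite_over J T) -> (forall T, #|T| = m -> indep_mod J T) ->
  J f -> nu \in msupp f ->
  ~ (forall k, k \in msupp f -> k != nu -> wdot w nu < wdot w k).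
Proof.
move=> cB mn JG finJ indJ Jf nuf numin; have [JI _] := JG.
set c := wdot w nu in numin; have bbI := bb_ideal c JI.
have bb_nu : bb c 'X_[nu].
  have f0 : f@_nu != 0 by rewrite -mcoeff_msupp.
  (* Normalizing f cancels the term at nu, and the rest is heavier than c. *)
  exists ('X_[nu] - (f@_nu)^-1 *: f); last by rewrite opprB addrC subrK; apply: is_idealZ.
  move=> k; rewrite mcoeff_msupp mcoeffB mcoeffX mcoeffZ.
  have [<-|knu] := eqVneq nu k; first by rewrite mulVf // subrr eqxx.
  rewrite sub0r oppr_eq0 mulf_eq0 negb_or => /andP[_]; rewrite -mcoeff_msupp => kf.
  by apply: numin; rewrite // eq_sym.
have [i0 i0B] : exists i0, i0 \notin B.
  have : (0 < #|~: B|)%N by rewrite cardsCs setCK card_ord subn_gt0 cB.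
  by case/card_gt0P => i0; rewrite inE; exists i0.
pose T := i0 |: B; have cT : #|T| = m by rewrite cardsU1 i0B.
(* Trade one factor x_i for x_i0^N, both weightless. Modulo J, x_i0^N equals [q], whose terms
   contain x_i, which restores a multiple of x^mu, or a variable of B, which raises the weight above
   c. *)
have main (t : nat) (mu : 'X_{1..n}) : (\sum_(i | i \notin T) mu i < t)%N -> wdot w mu = c -> bb c 'X_[mu] ->
    exists mu' : 'X_{1..n}, [/\ forall i, i \notin T -> mu' i = 0%N, wdot w mu' = c & bb c 'X_[mu']].
  elim: t mu => // t IH mu mut muc bbmu.
  have [/forallP mu0|] := boolP [forall i, (i \notin T) ==> (mu i == 0%N)].
    by exists mu; split=> // i /(implyP (mu0 i)) /eqP.
  rewrite negb_forall => /existsP [i]; rewrite negb_imply => /andP[iT mui].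
  have iB : i \notin B by apply: contra iT => iB; rewrite inE iB orbT.
  have ii0 : i0 != i by apply: contraNneq iT => <-; rewrite setU11.
  have [|N HN] := finJ (i |: B); first by rewrite cardsU1 iB.
  have [phi Jphi phiE] := HN i0.
  pose q : {mpoly K[n]} := 'X_i0 ^+ N - phi.
  have q0 : restr (i |: B) q = 0 by rewrite linearB /= phiE subrr.
  have muE : mu = ((mu - U_(i)) + U_(i))%MM by rewrite submK // lep1mP.
  have muc' : wdot w (mu - U_(i))%MM = c.
    by rewrite -muc [in RHS]muE wdotD wdotU w_notB ?addr0.
  apply: (IH (mu - U_(i) + U_(i0) *+ N)%MM).
  - move: mut; rewrite ltnS; apply: leq_trans.
    rewrite (bigD1 i iT) [X in (_ < X)%N](bigD1 i iT) /= -addSn leq_add //.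
      by rewrite mnmDE mnmBE mulmnE !mnm1E eqxx (negbTE ii0) mul0n addn0 subn1 prednK ?lt0n.
    apply: leq_sum => j /andP[jT _]; have i0j : i0 != j.
      by apply: contraNneq jT => <-; rewrite setU11.
    by rewrite mnmDE mnmBE mulmnE !mnm1E (negbTE i0j) mul0n addn0 leq_subr.
  - by rewrite wdotD muc' wdotMn wdotU w_notB ?mul0r ?addr0.
  rewrite mpolyXD -mpolyXn -[X in _ * X](subrK phi) -/q mulrDr.
  apply: (is_idealD bbI); last first.
    apply: (is_idealMl bbI); exists 0 => //; by rewrite subr0.
  apply: (@mpoly_msupp_ind _ _ (fun p => bb c ('X_[mu - U_(i)] * p))).
  - by rewrite mulr0; apply: (is_ideal0 bbI).
  - by move=> p p' bp bp'; rewrite mulrDr; apply: (is_idealD bbI).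
  move=> a k kq; rewrite -scalerAr; apply: (is_idealZ bbI).
  have [j] := restr0P q0 kq; rewrite inE => /orP[/set1P ->|jB] kj.
    have kE : k = (U_(i) + (k - U_(i)))%MM by rewrite addmC submK // lep1mP.
    by rewrite kE mpolyXD mulrA -mpolyXD -muE; apply: (is_idealMr bbI).
  apply: gt_bb => //; rewrite -mpolyXD => l /mem_msuppXP <-.
  by rewrite wdotD muc' ltrDl; apply: (wdot_gt0 w_ge0 (w_B jB)).
have [mu [muT muc [G Gc JuG]]] := main _ nu (ltnSn _) (erefl _) bb_nu.
have [r [b H]] := finite_over_fingen JG (finJ T cT).
(* Multiplication by G modulo J as a matrix over K[x_T] whose entries have only terms heavier than
   c. *)
have /fin_all_exists [Q HQ] (e : 'I_r) : exists Q : 'I_r -> {mpoly K[n]},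
    [/\ forall e', restr (~: T) (Q e') = Q e', forall e', gt c (Q e') &
        J (G * b e - \sum_e' Q e' * b e')].
  have Gbc : gt c (G * b e) by apply: gtMr.
  apply: (@mpoly_msupp_ind _ _ (fun p => exists Q : 'I_r -> {mpoly K[n]},
    [/\ forall e', restr (~: T) (Q e') = Q e', forall e', gt c (Q e') &
        J (p - \sum_e' Q e' * b e')])).
  - exists (fun=> 0); split=> [e'|//|]; first by rewrite linear0.
    by rewrite big1 ?subrr => [|e' _]; [apply: is_ideal0|rewrite mul0r].
  - move=> p p' [s [sT sc Js]] [s' [sT' sc' Js']]; exists (fun e' => s e' + s' e').
    split=> [e'|e'|]; [by rewrite linearD /= sT sT' | exact: gtD |].
    under eq_bigr => e' _ do rewrite mulrDl.
    by rewrite big_split opprD addrACA; apply: is_idealD.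
  move=> a k /Gbc kc.
  (* The part of k in T carries its whole weight, as B lies in T; only the weightless rest is
     rewritten in the generators. *)
  pose kT := [multinom if i \in T then k i else 0%N | i < n].
  pose kR := [multinom if i \in T then 0%N else k i | i < n].
  have kE : k = (kT + kR)%MM.
    by apply/mnmP => i; rewrite mnmDE !mnmE; case: ifP => _; rewrite ?addn0.
  have kTw : wdot w kT = wdot w k.
    rewrite kE wdotD; suff -> : wdot w kR = 0 by rewrite addr0.
    rewrite /wdot big1 // => i _; rewrite mnmE; case: ifP => iT; first by rewrite mulr0.
    by rewrite w_notB ?mul0r //; apply: contraFN iT => iB; rewrite inE iB orbT.
  have [s sT Js] := H 'X_[kR].
  exists (fun e' => a *: 'X_[kT] * s e'); split=> [e'|e'|].
  - rewrite rmorphM /= sT linearZ /= restr_id // => k' /mem_msuppXP <- i.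
    by rewrite inE mnmE => /negbTE ->.
  - by apply: gtMr; apply: gtZ => k' /mem_msuppXP <-; rewrite kTw.
  have -> : a *: 'X_[k] - \sum_e' a *: 'X_[kT] * s e' * b e' =
      a *: 'X_[kT] * ('X_[kR] - \sum_e' s e' * b e').
    rewrite mulrBr mulr_sumr -scalerAl -mpolyXD -kE; congr (_ - _).
    by apply: eq_bigr => e' _; rewrite mulrA.
  exact: is_idealMl.
pose QM := \matrix_(e, e') Q e e'; pose u : {mpoly K[n]} := 'X_[mu].
have [s1 _ Js1] := H 1.
have Jdet : J (\det (u%:M - QM)).
  apply: (fingen_det JI Js1) => e.
  have -> : \sum_e' (u%:M - QM) e e' * b e' =
      (u - G) * b e + (G * b e - \sum_e' Q e e' * b e').
    under eq_bigr => e' _ do rewrite !mxE mulrBl.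
    rewrite sumrB (bigD1 e) //= eqxx mulr1n big1 ?addr0 => [|e' e'e]; first by ring.
    by rewrite eq_sym (negbTE e'e) mulr0n mul0r.
  by apply: is_idealD => //; [apply: is_idealMr | case: (HQ e)].
have det0 : \det (u%:M - QM) = 0.
  apply: (indJ T) => //; rewrite -det_map_mx; congr (\det _); apply/matrixP => e e'.
  rewrite !mxE /= rmorphB /= rmorphMn /= restr_id.
    by case: (HQ e) => -> _ _.
  by move=> k /mem_msuppXP <- i; rewrite inE; apply: muT.
have QMc e e' : gt c (QM e e') by rewrite mxE; case: (HQ e).
have uc : ge c u by move=> k /mem_msuppXP <-; rewrite muc.
(* All terms of det - u^r should weigh more than r c, but with det = 0 the term -x^(r mu) weighs
   exactly r c. *)
have /(_ (mu *+ r)%MM) := weight_det_sub uc QMc.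
rewrite det0 sub0r mcoeff_msupp mcoeffN mpolyXn mcoeffX eqxx oppr_eq0 oner_neq0.
by rewrite wdotMn muc mulrC ltxx => /(_ isT).
Qed.

End Weights.

(** A shift and a small perturbation make the weight positive exactly on a set of m - 1 indices, as
    [no_weight_monomial] demands. *)
Lemma skeleton_sub_trop w : (m < n)%N -> is_graded J ->
  (forall T, #|T| = m -> finite_over J T) -> (forall T, #|T| = m -> indep_mod J T) ->
  skeleton m w -> trop J w.
Proof.
move=> mn JG finJ indJ [A [/set0Pn [a aA] [Am wA]]] f Jf /initf_monomialP [nu nuf numin].
have [JI JGh] := JG; have wa := wA a aA.
have cA := max_card (mem A); rewrite card_ord in cA.
(* At most m - 1 indices lie outside A, so B can contain them all; indices outside B are then
   minimal. *)
have [|B [AB _ cB]] := @exists_subset_card _ (~: A) setT m.-1 (subsetT _).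
  by rewrite cardsT [#|~: A|]cardsCs setCK card_ord; lia.
have cB1 : #|B|.+1 = m by rewrite cB prednK //; lia.
(* Within one degree, subtracting the minimum from every coordinate shifts all weights equally. *)
pose h := pihomog mdeg (mdeg nu) f.
have hsupp k : k \in msupp h -> k \in msupp f /\ mdeg k = mdeg nu.
  by rewrite !mcoeff_msupp mcoeff_pihomog; case: (mdeg k =P mdeg nu) => // _; rewrite eqxx.
have nuh : nu \in msupp h by rewrite mcoeff_msupp mcoeff_pihomog eqxx -mcoeff_msupp.
pose d := (mdeg nu)%:R : R.
(* The perturbation by e must not disturb the minimality of nu. *)
have [e e_gt0 He] : exists2 e : R, 0 < e &
    forall k, k \in msupp h -> k != nu -> e * (d + 1) <= wdot w k - wdot w nu.
  have : {subset msupp h <= msupp h} by [].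
  elim: {1 3}(msupp h) => [|l s IH] sh; first by exists 1.
  have [|e e_gt0 He] := IH; first by move=> k ks; apply: sh; rewrite inE ks orbT.
  have d1 : 0 < d + 1 by rewrite ltr_wpDl // ler0n.
  have [->|lnu] := eqVneq l nu.
    by exists e => // k; rewrite inE => /orP[/eqP ->|/He //]; rewrite eqxx.
  pose x := wdot w l - wdot w nu.
  have x_gt0 : 0 < x.
    by rewrite subr_gt0 numin //; case: (hsupp l) => //; apply: sh; rewrite inE eqxx.
  exists (Num.min e (x / (d + 1))); first by rewrite lt_min e_gt0 divr_gt0.
  move=> k; rewrite inE => /orP[/eqP -> _|ks knu].
    by rewrite -ler_pdivlMr // ge_min lexx orbT.
  apply: le_trans (He k ks knu); rewrite ler_pM2r //.
  by rewrite ge_min lexx.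
pose w' : 'rV[R]_n := \row_i (w 0 i - w 0 a + e * (i \in B)%:R).
have w'B i : i \in B -> 0 < w' 0 i.
  by move=> iB; rewrite mxE iB mulr1 ltr_wpDl // subr_ge0.
have w'nB i : i \notin B -> w' 0 i = 0.
  move=> iB; rewrite mxE (negbTE iB) mulr0 addr0; apply/eqP; rewrite subr_eq0 eq_le wa andbT.
  by apply: wA; apply: contraR iB => iA; apply: (subsetP AB); rewrite inE.
have w'ge0 i : 0 <= w' 0 i by case: (boolP (i \in B)) => [/w'B /ltW|/w'nB ->].
apply: (no_weight_monomial w'ge0 w'B w'nB cB1 (ltnW mn) JG finJ indJ (JGh f Jf (mdeg nu)) nuh).
move=> k kh knu; pose Bdeg (l : 'X_{1..n}) : R := \sum_(i < n) (i \in B)%:R * (l i)%:R.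
have w'E l : wdot w' l = wdot w l - w 0 a * (mdeg l)%:R + e * Bdeg l.
  rewrite mdegE natr_sum /Bdeg !mulr_sumr /wdot -sumrB -big_split.
  by apply: eq_bigr => i _; rewrite mxE /=; ring.
have Bnu : Bdeg nu <= d.
  rewrite /Bdeg /d mdegE natr_sum; apply: ler_sum => i _.
  by case: (i \in B); rewrite ?mul1r // mul0r ler0n.
have Bk : 0 <= Bdeg k by apply: sumr_ge0 => i _; rewrite mulr_ge0 // ler0n.
(* The gap of at least e (d + 1) exceeds the loss from the perturbation, which is at most e d. *)
have := He k kh knu; have [_ kd] := hsupp k kh.
rewrite !w'E kd; nra.
Qed.

End TropicalInclusions.

(* gT(I) = W_n^m : for all g in some nonempty Zariski-open subset of GL_n(K),
   T(g(I)) = W_n^m as sets. *)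
Theorem theorem8p3 (R : realType) (K : closedFieldType)
  (charK0 : [pchar K] =i pred0) (n m : nat) (I : polyset K n) :
  is_graded I -> is_prime I -> quot_dim I m -> (m < n)%N ->
  exists U : 'M[K]_n -> Prop,
    [/\ zariski_open_GL U, (exists g, U g) &
        forall g, U g -> forall w : 'rV[R]_n,
          trop (gact_set g I) w <-> skeleton m w].
Proof.
move=> IG _ dimI mn; have [U [openU neU genU]] := generic_finite_over IG dimI (ltnW mn).
exists U; split=> // g /genU [gU fing] w.
(* The prime chain of length m is carried to g(I), where with finiteness it yields independence over
   every set of size m. *)
have gG := gact_set_graded IG gU; have chg := (prime_chain_gact I m gU).2 dimI.1.
split; first exact: trop_sub_skeleton.
apply: skeleton_sub_trop => // T cT.
exact: (finite_over_indep gG chg cT (fing T cT)).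
Qed.
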